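(* The following is provable in $\mathsf{ACA}_0^\omega$: if $f:[0,1]\to\mathbb{R}$ is regulated, then there is a sequence of reals containing all jump discontinuities of $f$.
   Context: $\mathsf{ACA}_0^\omega=\mathsf{RCA}_0^\omega+(\exists^2)$, where $\mathsf{RCA}_0^\omega$ is Kohlenbach's base theory of higher-order arithmetic (all finite types; basic arithmetic, combinators, primitive recursor, extensionality, quantifier-free induction, $\mathsf{QF\text{-}AC}^{1,0}$) and $(\exists^2)$ asserts the existence of $E:\mathbb{N}^{\mathbb{N}}\to\{0,1\}$ with $E(f)=0\leftrightarrow(\exists n)(f(n)=0)$. $f$ is regulated if $f(x-)=\lim_{y\to x-}f(y)$ and $f(x+)=\lim_{y\to x+}f(y)$ exist at every point. A jump discontinuity is a point $x$ where both one-sided limits exist but $f(x-)\neq f(x+)$. *)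

(* Defs.v *)
From Stdlib Require Import List.
Import ListNotations.

Set Implicit Arguments.
Unset Strict Implicit.
Unset Printing Implicit Defensive.

(** * Finite types, terms and formulas

    Terms and formulas are intrinsically typed, with de Bruijn indices: a
    context lists the types of the free variables, most recently bound first. *)

Inductive ty : Type := Nat | Arr (rho tau : ty).

Declare Scope ty_scope.
Delimit Scope ty_scope with ty.
Bind Scope ty_scope with ty.
Notation "rho ~> tau" := (Arr rho tau) (at level 55, right associativity) : ty_scope.
Open Scope ty_scope.

Notation ty1 := (Nat ~> Nat).
Notation ty2 := (ty1 ~> Nat).

Definition ctx := list ty.

Inductive var : ctx -> ty -> Type :=
| VZ (G : ctx) (rho : ty) : var (rho :: G) rho
| VS (G : ctx) (rho sigma : ty) (x : var G rho) : var (sigma :: G) rho.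
Arguments VZ {G rho}.
Arguments VS {G rho sigma} x.

Inductive tm (G : ctx) : ty -> Type :=
| Var (rho : ty) (x : var G rho) : tm G rho
| App (rho tau : ty) (s : tm G (rho ~> tau)) (t : tm G rho) : tm G tau
| Zero : tm G Nat
| One : tm G Nat
| CAdd : tm G (Nat ~> Nat ~> Nat)
| CMul : tm G (Nat ~> Nat ~> Nat)
| CPi (rho tau : ty) : tm G (rho ~> tau ~> rho)
| CSigma (rho sigma tau : ty) :
    tm G ((rho ~> sigma ~> tau) ~> (rho ~> sigma) ~> rho ~> tau)
| CRec : tm G ((Nat ~> Nat ~> Nat) ~> Nat ~> Nat ~> Nat).
Arguments Zero {G}.
Arguments One {G}.
Arguments CAdd {G}.
Arguments CMul {G}.
Arguments CPi {G rho tau}.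
Arguments CSigma {G rho sigma tau}.
Arguments CRec {G}.

(** The only relations are [=] and [<] at type 0.  The logic is classical, so
    falsity, implication and the universal quantifier suffice. *)
Inductive fm : ctx -> Type :=
| Eq (G : ctx) (s t : tm G Nat) : fm G
| Lt (G : ctx) (s t : tm G Nat) : fm G
| Bot (G : ctx) : fm G
| Imp (G : ctx) (A B : fm G) : fm G
| All (G : ctx) (rho : ty) (A : fm (rho :: G)) : fm G.
Arguments Bot {G}.
Arguments All {G} rho A.

Definition Not (G : ctx) (A : fm G) : fm G := Imp A Bot.
Definition And (G : ctx) (A B : fm G) : fm G := Not (Imp A (Not B)).
Definition Or (G : ctx) (A B : fm G) : fm G := Imp (Not A) B.
Definition Iff (G : ctx) (A B : fm G) : fm G := And (Imp A B) (Imp B A).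
Definition Ex (G : ctx) (rho : ty) (A : fm (rho :: G)) : fm G :=
  Not (All rho (Not A)).
Arguments Ex {G} rho A.

Declare Scope tm_scope.
Delimit Scope tm_scope with tm.
Bind Scope tm_scope with tm.
Notation "s @ t" := (App s t) (at level 11, left associativity) : tm_scope.
Notation "0" := Zero : tm_scope.
Notation "1" := One : tm_scope.
Notation "s + t" := (App (App CAdd s) t) : tm_scope.
Notation "s * t" := (App (App CMul s) t) : tm_scope.

Declare Scope fm_scope.
Delimit Scope fm_scope with fm.
Bind Scope fm_scope with fm.
Notation "s == t" := (Eq s t) (at level 70, no associativity) : fm_scope.
Notation "s < t" := (Lt s t) : fm_scope.
Notation "~ A" := (Not A) : fm_scope.
Notation "A /\ B" := (And A B) : fm_scope.
Notation "A \/ B" := (Or A B) : fm_scope.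
Notation "A <-> B" := (Iff A B) : fm_scope.
Notation "A --> B" := (Imp A B) (at level 99, right associativity) : fm_scope.
Open Scope tm_scope.
Open Scope fm_scope.

Definition nat_le (G : ctx) (s t : tm G Nat) : fm G := s < t \/ s == t.

Definition v0 {G : ctx} {a : ty} : tm (a :: G) a := Var VZ.
Definition v1 {G : ctx} {a b : ty} : tm (b :: a :: G) a := Var (VS VZ).
Definition v2 {G : ctx} {a b c : ty} : tm (c :: b :: a :: G) a :=
  Var (VS (VS VZ)).
Definition v3 {G : ctx} {a b c d : ty} : tm (d :: c :: b :: a :: G) a :=
  Var (VS (VS (VS VZ))).
Definition v4 {G : ctx} {a b c d e : ty} : tm (e :: d :: c :: b :: a :: G) a :=
  Var (VS (VS (VS (VS VZ)))).
Definition v5 {G : ctx} {a b c d e f : ty} :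
    tm (f :: e :: d :: c :: b :: a :: G) a :=
  Var (VS (VS (VS (VS (VS VZ))))).

(** * Renaming and substitution *)

Definition ren (G D : ctx) : Type := forall rho, var G rho -> var D rho.
Definition sub (G D : ctx) : Type := forall rho, var G rho -> tm D rho.

Fixpoint ren_tm (G D : ctx) (r : ren G D) (rho : ty) (t : tm G rho) : tm D rho :=
  match t with
  | Var x => Var (r _ x)
  | App s t => App (ren_tm r s) (ren_tm r t)
  | Zero => Zero
  | One => One
  | CAdd => CAdd
  | CMul => CMul
  | CPi => CPi
  | CSigma => CSigma
  | CRec => CRec
  end.

Fixpoint sub_tm (G D : ctx) (r : sub G D) (rho : ty) (t : tm G rho) : tm D rho :=
  match t with
  | Var x => r _ x
  | App s t => App (sub_tm r s) (sub_tm r t)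
  | Zero => Zero
  | One => One
  | CAdd => CAdd
  | CMul => CMul
  | CPi => CPi
  | CSigma => CSigma
  | CRec => CRec
  end.

Definition ren_shift {G : ctx} {a : ty} : ren G (a :: G) := fun _ x => VS x.

Definition ren_up (G D : ctx) (a : ty) (r : ren G D) : ren (a :: G) (a :: D) :=
  fun rho x =>
    match x in var G' rho'
      return match G' with
             | [] => unit
             | b :: G0 => ren G0 D -> var (b :: D) rho'
             end with
    | VZ => fun _ => VZ
    | VS y => fun r => VS (r _ y)
    end r.

Definition sub_cons (G D : ctx) (a : ty) (t : tm D a) (r : sub G D) :
    sub (a :: G) D :=
  fun rho x =>
    match x in var G' rho'
      return match G' with
             | [] => unit
             | b :: G0 => tm D b -> sub G0 D -> tm D rho'
             end with
    | VZ => fun t _ => t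
    | VS y => fun _ r => r _ y
    end t r.

Definition sub_up (G D : ctx) (a : ty) (r : sub G D) : sub (a :: G) (a :: D) :=
  sub_cons v0 (fun rho x => ren_tm ren_shift (r rho x)).

Fixpoint ren_fm (G D : ctx) (r : ren G D) (A : fm G) : fm D :=
  match A in fm G' return ren G' D -> fm D with
  | Eq s t => fun r => Eq (ren_tm r s) (ren_tm r t)
  | Lt s t => fun r => Lt (ren_tm r s) (ren_tm r t)
  | Bot => fun _ => Bot
  | Imp A B => fun r => Imp (ren_fm r A) (ren_fm r B)
  | All rho A => fun r => All rho (ren_fm (ren_up r) A)
  end r.

Fixpoint sub_fm (G D : ctx) (r : sub G D) (A : fm G) : fm D :=
  match A in fm G' return sub G' D -> fm D with
  | Eq s t => fun r => Eq (sub_tm r s) (sub_tm r t)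
  | Lt s t => fun r => Lt (sub_tm r s) (sub_tm r t)
  | Bot => fun _ => Bot
  | Imp A B => fun r => Imp (sub_fm r A) (sub_fm r B)
  | All rho A => fun r => All rho (sub_fm (sub_up r) A)
  end r.

Definition sub_id {G : ctx} : sub G G := fun _ x => Var x.
Definition inst (G : ctx) (a : ty) (A : fm (a :: G)) (t : tm G a) : fm G :=
  sub_fm (sub_cons t sub_id) A.

Fixpoint lift_var (D G : ctx) (rho : ty) (x : var G rho) : var (D ++ G) rho :=
  match D with
  | [] => x
  | _ :: D' => VS (lift_var D' x)
  end.
Definition lift (D G : ctx) (rho : ty) (t : tm G rho) : tm (D ++ G) rho :=
  ren_tm (fun _ x => lift_var D x) t.

(** * Classical many-sorted natural deduction with equality at type 0

    A theory selects its axioms in every context, which accounts for the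
    parameters of the axiom schemes. *)

Definition theory := forall G : ctx, fm G -> Prop.

Inductive derives (T : theory) : forall G : ctx, list (fm G) -> fm G -> Prop :=
| d_ax G (H : list (fm G)) A : T G A -> derives T H A
| d_hyp G (H : list (fm G)) A : In A H -> derives T H A
| d_imp_intro G (H : list (fm G)) A B :
    derives T (A :: H) B -> derives T H (A --> B)
| d_imp_elim G (H : list (fm G)) A B :
    derives T H (A --> B) -> derives T H A -> derives T H B
| d_raa G (H : list (fm G)) A : derives T ((~ A) :: H) Bot -> derives T H A
| d_all_intro G (H : list (fm G)) rho (A : fm (rho :: G)) :
    derives T (map (ren_fm ren_shift) H) A -> derives T H (All rho A)
| d_all_elim G (H : list (fm G)) rho (A : fm (rho :: G)) (t : tm G rho) :
    derives T H (All rho A) -> derives T H (inst A t)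
| d_eq_refl G (H : list (fm G)) (t : tm G Nat) : derives T H (t == t)
| d_eq_subst G (H : list (fm G)) (A : fm (Nat :: G)) (s t : tm G Nat) :
    derives T H (s == t) -> derives T H (inst A s) -> derives T H (inst A t).

Definition provable (T : theory) (A : fm []) : Prop := derives T [] A.

(** * The theories *)

(** Equality at higher types is defined pointwise. *)
Fixpoint eq_ty (rho : ty) : forall G : ctx, tm G rho -> tm G rho -> fm G :=
  match rho return forall G, tm G rho -> tm G rho -> fm G with
  | Nat => fun G s t => s == t
  | a ~> b => fun G s t => All a (eq_ty (lift [a] s @ v0) (lift [a] t @ v0))
  end.

Fixpoint quantifier_free (G : ctx) (A : fm G) : Prop :=
  match A with
  | Eq _ _ | Lt _ _ | Bot => True
  | Imp A B => quantifier_free A /\ quantifier_free B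
  | All _ _ => False
  end.

Inductive RCA0w : theory :=
(* the axioms of discrete ordered semirings, in Simpson's presentation *)
| ax_succ_nonzero G : RCA0w (G := G) (All Nat (~ v0 + 1 == 0))
| ax_succ_inj G :
    RCA0w (G := G) (All Nat (All Nat (v1 + 1 == v0 + 1 --> v1 == v0)))
| ax_add_zero G : RCA0w (G := G) (All Nat (v0 + 0 == v0))
| ax_add_succ G :
    RCA0w (G := G) (All Nat (All Nat (v1 + (v0 + 1) == (v1 + v0) + 1)))
| ax_mul_zero G : RCA0w (G := G) (All Nat (v0 * 0 == 0))
| ax_mul_succ G :
    RCA0w (G := G) (All Nat (All Nat (v1 * (v0 + 1) == v1 * v0 + v1)))
| ax_lt_zero G : RCA0w (G := G) (All Nat (~ v0 < 0))
| ax_lt_succ G :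
    RCA0w (G := G)
      (All Nat (All Nat (v1 < v0 + 1 <-> (v1 < v0 \/ v1 == v0))))
| ax_Pi G rho tau :
    RCA0w (G := G) (All rho (All tau (eq_ty (CPi @ v1 @ v0) v1)))
| ax_Sigma G rho sigma tau :
    RCA0w (G := G)
      (All (rho ~> sigma ~> tau) (All (rho ~> sigma) (All rho
        (eq_ty (CSigma @ v2 @ v1 @ v0) (v2 @ v0 @ (v1 @ v0))))))
| ax_rec_zero G :
    RCA0w (G := G)
      (All (Nat ~> Nat ~> Nat) (All Nat (CRec @ v1 @ v0 @ 0 == v0)))
| ax_rec_succ G :
    RCA0w (G := G)
      (All (Nat ~> Nat ~> Nat) (All Nat (All Nat
        (CRec @ v2 @ v1 @ (v0 + 1) == v2 @ v0 @ (CRec @ v2 @ v1 @ v0)))))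
| ax_ext G rho tau :
    RCA0w (G := G)
      (All rho (All rho (All (rho ~> tau)
        (eq_ty v2 v1 --> eq_ty (v0 @ v2) (v0 @ v1)))))
| ax_qf_ind G (A : fm (Nat :: G)) : quantifier_free A ->
    RCA0w (inst A 0 -->
      All Nat (A --> sub_fm (sub_cons (v0 + 1) (fun _ x => Var (VS x))) A) -->
      All Nat A)
(* QF-AC^{1,0}; in [A] the number is [v0] and the function is [v1] *)
| ax_qf_ac G (A : fm (Nat :: ty1 :: G)) : quantifier_free A ->
    RCA0w (All ty1 (Ex Nat A) -->
      Ex ty2 (All ty1
        (sub_fm (sub_cons (v1 @ v0) (sub_cons v0 (fun _ x => Var (VS (VS x)))))
          A))).

Definition exists2_axiom {G : ctx} : fm G :=
  Ex ty2 (All ty1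
    ((v1 @ v0 == 0 \/ v1 @ v0 == 1) /\
     (v1 @ v0 == 0 <-> Ex Nat (v1 @ v0 == 0)))).

Inductive ACA0w : theory :=
| aca_rca G (A : fm G) : RCA0w A -> ACA0w A
| aca_exists2 G : ACA0w (G := G) exists2_axiom.

(** * Rational numbers

    Rationals are coded by numbers: the code [<<a,b>,d>] stands for
    [(a - b) / (d + 1)], where [<i,j> = (i+j)^2 + i] is an injective pairing. *)

Definition pair (G : ctx) (i j : tm G Nat) : tm G Nat := (i + j) * (i + j) + i.
Definition rat_code (G : ctx) (a b d : tm G Nat) : tm G Nat := pair (pair a b) d.

(** Formal fractions [(fpos - fneg) / fden], used only to build formulas. *)
Record frac (G : ctx) := Frac { fpos : tm G Nat; fneg : tm G Nat; fden : tm G Nat }.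

Definition frac_add (G : ctx) (p q : frac G) : frac G :=
  Frac (fpos p * fden q + fpos q * fden p)
       (fneg p * fden q + fneg q * fden p)
       (fden p * fden q).
Definition frac_cmp (rel : forall G, tm G Nat -> tm G Nat -> fm G)
    (G : ctx) (p q : frac G) : fm G :=
  rel G (fpos p * fden q + fneg q * fden p) (fpos q * fden p + fneg p * fden q).

Fixpoint numeral {G : ctx} (n : nat) : tm G Nat :=
  match n with O => 0 | S n => numeral n + 1 end.

Definition exp2 {G : ctx} : tm G ty1 :=
  let id : tm G ty1 := CSigma @ CPi @ (CPi : tm G (Nat ~> Nat ~> Nat)) in
  CRec @ (CPi @ (CSigma @ CAdd @ id)) @ 1.

Definition dyadic (G : ctx) (i : nat) (m : tm G Nat) : frac G :=
  Frac (numeral i) 0 (exp2 @ m).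

(** [u] and [v] are codes of rationals and [u + i/2^m rel v + j/2^n]. *)
Definition rat_cmp (rel : forall G, tm G Nat -> tm G Nat -> fm G) (G : ctx)
    (u : tm G Nat) (i : nat) (m : tm G Nat)
    (v : tm G Nat) (j : nat) (n : tm G Nat) : fm G :=
  let D := [Nat; Nat; Nat; Nat; Nat; Nat] in
  Ex Nat (Ex Nat (Ex Nat (Ex Nat (Ex Nat (Ex Nat
    (lift D u == rat_code v5 v4 v3 /\
     lift D v == rat_code v2 v1 v0 /\
     frac_cmp rel
       (frac_add (Frac v5 v4 (v3 + 1)) (dyadic i (lift D m)))
       (frac_add (Frac v2 v1 (v0 + 1)) (dyadic j (lift D n))))))))).

Definition rat_lt := rat_cmp Lt.
Definition rat_le := rat_cmp nat_le.

(** * Real numbers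

    A real is coded by a sequence of rationals with [|q_n - q_(n+i)| < 2^-n]. *)

Definition is_real (G : ctx) (x : tm G ty1) : fm G :=
  let x' := lift [Nat; Nat] x in
  All Nat (All Nat
    (rat_lt (x' @ v1) 0 v1 (x' @ (v1 + v0)) 1 v1 /\
     rat_lt (x' @ (v1 + v0)) 0 v1 (x' @ v1) 1 v1)).

(** [|x_n - y_n| <= 2^(-n+1)] for all [n] *)
Definition real_eq (G : ctx) (x y : tm G ty1) : fm G :=
  let x' := lift [Nat] x in
  let y' := lift [Nat] y in
  All Nat (rat_le (x' @ v0) 0 v0 (y' @ v0) 2 v0 /\
           rat_le (y' @ v0) 0 v0 (x' @ v0) 2 v0).

(** [x_n + 2^(-n+1) < y_n] for some [n] *)
Definition real_lt (G : ctx) (x y : tm G ty1) : fm G :=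
  Ex Nat (rat_lt (lift [Nat] x @ v0) 2 v0 (lift [Nat] y @ v0) 0 v0).

Definition real_le (G : ctx) (x y : tm G ty1) : fm G := ~ real_lt y x.

(** [|x - y| < 2^-k], that is [|x_n - y_n| + 2^(-n+1) < 2^-k] for some [n] *)
Definition real_close (G : ctx) (x y : tm G ty1) (k : tm G Nat) : fm G :=
  let x' := lift [Nat] x in
  let y' := lift [Nat] y in
  let k' := lift [Nat] k in
  Ex Nat (rat_lt (x' @ v0) 2 v0 (y' @ v0) 1 k' /\
          rat_lt (y' @ v0) 2 v0 (x' @ v0) 1 k').

Definition real0 {G : ctx} : tm G ty1 := CPi @ rat_code 0 0 0.
Definition real1 {G : ctx} : tm G ty1 := CPi @ rat_code 1 0 0.

(** * Functions from the unit interval to the reals *)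

Definition in_unit (G : ctx) (x : tm G ty1) : fm G :=
  is_real x /\ real_le real0 x /\ real_le x real1.

Definition unit_fun (G : ctx) (f : tm G (ty1 ~> ty1)) : fm G :=
  All ty1 (in_unit v0 --> is_real (lift [ty1] f @ v0)) /\
  All ty1 (All ty1
    (in_unit v1 --> in_unit v0 --> real_eq v1 v0 -->
     real_eq (lift [ty1; ty1] f @ v1) (lift [ty1; ty1] f @ v0))).

(** For all [k] there is [N] such that all [y] in the unit interval with
    [y < x] and [|x - y| < 2^-N] satisfy [|f y - l| < 2^-k]. *)
Definition left_limit (G : ctx) (f : tm G (ty1 ~> ty1)) (x l : tm G ty1) : fm G :=
  let D := [ty1; Nat; Nat] in
  All Nat (Ex Nat (All ty1
    (in_unit v0 --> real_lt v0 (lift D x) --> real_close (lift D x) v0 v1 -->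
     real_close (lift D f @ v0) (lift D l) v2))).

Definition right_limit (G : ctx) (f : tm G (ty1 ~> ty1)) (x l : tm G ty1) : fm G :=
  let D := [ty1; Nat; Nat] in
  All Nat (Ex Nat (All ty1
    (in_unit v0 --> real_lt (lift D x) v0 --> real_close (lift D x) v0 v1 -->
     real_close (lift D f @ v0) (lift D l) v2))).

(** A left limit is not required at the left end point of the domain, where it
    makes no sense, and likewise on the right. *)
Definition regulated (G : ctx) (f : tm G (ty1 ~> ty1)) : fm G :=
  let f' := lift [ty1; ty1] f in
  All ty1 (in_unit v0 -->
    (real_lt real0 v0 --> Ex ty1 (is_real v0 /\ left_limit f' v1 v0)) /\
    (real_lt v0 real1 --> Ex ty1 (is_real v0 /\ right_limit f' v1 v0))).

Definition jump_discontinuity (G : ctx) (f : tm G (ty1 ~> ty1)) (x : tm G ty1) :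
    fm G :=
  let f' := lift [ty1; ty1] f in
  let x' := lift [ty1; ty1] x in
  real_lt real0 x /\ real_lt x real1 /\
  Ex ty1 (Ex ty1
    (is_real v1 /\ left_limit f' x' v1 /\
     is_real v0 /\ right_limit f' x' v0 /\
     ~ real_eq v1 v0)).

(* Main.v *)
From HB Require Import structures.
From mathcomp Require Import ssreflect ssrfun ssrbool eqtype ssrnat seq choice order.
From mathcomp Require Import ssralg ssrnum ring lra boolp.
From Stdlib Require Import List ClassicalEpsilon FunctionalExtensionality PropExtensionality.
Require Import Defs.
Import ListNotations.
Import Order.TTheory GRing.Theory Num.Theory.
Set Implicit Arguments.
Unset Strict Implicit.
Unset Printing Implicit Defensive.
Unset Asymmetric Patterns.
Bind Scope list_scope with list.
Local Open Scope list_scope.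
Local Open Scope type_scope.

(** By the completeness theorem for this calculus it is enough to argue inside an
    arbitrary extensional model [M] of the axioms, whose numbers may be nonstandard.
    The fractions of [M] form an ordered field, and [exists^2] turns every arithmetical
    formula into a term, which gives comprehension for arithmetical conditions on [f].

    Given a rational [p] and a number [k], consider the rationals [q] such that
    [|f a - f b| < 2^-k] for all rationals [a], [b] of the unit interval in [(p, q)].
    They form an initial segment that is arithmetical in [f], so its supremum in the
    unit interval can be computed from [(p, k)] by a term.  If [f] jumps at [x], choose
    [k] with [2 * 2^-k <= |f(x-) - f(x+)|] and [p < x] such that [f] stays within
    [2^-(k+1)] of [f(x-)] on [(p, x)]; then the supremum for [(p, k)] is [x]. *)

(** * Substitution *)

(** An arithmetical condition cannot quantify over reals, so neither the jumps nor the one-sided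
    limits can be searched for directly. Rationals suffice because the one-sided limits at x also
    control [f] at the rationals near x. Every pair [(p, k)] yields a point, whether or not it comes
    from a jump: nothing has to be selected, and the sequence may contain further points.

    The constants fit as follows. If q < x, two values of [f] on (p, q) are each within 2^-(k+1) of
    f(x-), so they differ by less than 2^-k. If q > x, there are rationals a < x < b in (p, q) with
    f(a) and f(b) within 2^-(k+1) of f(x-) and f(x+); if these differed by less than 2^-k, then
    |f(x-) - f(x+)| would be less than 2^-k + 2 * 2^-(k+1) = 2 * 2^-k.

    Induction is available for quantifier-free formulas only. The supremum is therefore approximated
    by a bounded search over dyadic grids, a recursion on the characteristic function of the
    condition. With that function as a parameter, the correctness of the search is a quantifier-free
    statement. *)

Lemma sub_ext (G D : ctx) (r s : sub G D) :
  (forall a (x : var G a), r a x = s a x) -> r = s.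
Proof.
move=> h; apply: functional_extensionality_dep => a.
by apply: functional_extensionality_dep => x; apply: h.
Qed.

(** The return type branches on the context because the index [a :: G] is not a variable and cannot
    be abstracted by a plain [match]. *)
Lemma var_cons (a : ty) (G : ctx) (P : forall b, var (a :: G) b -> Prop) :
  P a VZ -> (forall b (y : var G b), P b (VS y)) -> forall b x, P b x.
Proof.
move=> h0 hS b x; move: P h0 hS.
refine (match x as x0 in var G' b0 return
  match G' as G1 return var G1 b0 -> Prop with
  | [] => fun _ => True
  | a1 :: G1 => fun x1 => forall P : forall b, var (a1 :: G1) b -> Prop,
      P a1 VZ -> (forall b y, P b (VS y)) -> P b0 x1
  end x0 with VZ => _ | VS _ => _ end); by move=> P h0 hS.
Qed.

Definition ren_sub (G D : ctx) (r : ren G D) : sub G D := fun a x => Var (r a x).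
Definition sub_comp (G D K : ctx) (r : sub G D) (s : sub D K) : sub G K :=
  fun a x => sub_tm s (r a x).

Lemma ren_tm_sub (G D : ctx) (r : ren G D) a (t : tm G a) :
  ren_tm r t = sub_tm (ren_sub r) t.
Proof. by elim: t => //= ? ? s -> t ->. Qed.

Lemma sub_tm_comp (G D K : ctx) (r : sub G D) (s : sub D K) a (t : tm G a) :
  sub_tm s (sub_tm r t) = sub_tm (sub_comp r s) t.
Proof. by elim: t => //= ? ? f -> t ->. Qed.

Lemma eq_sub_tm (G D : ctx) (r s : sub G D) a (t : tm G a) :
  (forall b (x : var G b), r b x = s b x) -> sub_tm r t = sub_tm s t.
Proof. by move=> /sub_ext ->. Qed.

Lemma eq_sub_fm (G D : ctx) (r s : sub G D) (A : fm G) :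
  (forall b (x : var G b), r b x = s b x) -> sub_fm r A = sub_fm s A.
Proof. by move=> /sub_ext ->. Qed.

Lemma sub_tm_id (G : ctx) a (t : tm G a) : sub_tm sub_id t = t.
Proof. by elim: t => //= ? ? f -> t ->. Qed.

Lemma ren_up_sub (G D : ctx) a (r : ren G D) :
  ren_sub (@ren_up G D a r) = sub_up (ren_sub r).
Proof. by apply: sub_ext; apply: var_cons. Qed.

Lemma ren_fm_sub (G D : ctx) (r : ren G D) (A : fm G) :
  ren_fm r A = sub_fm (ren_sub r) A.
Proof.
elim: A D r => //= {G}.
- by move=> G s t D r; rewrite !ren_tm_sub.
- by move=> G s t D r; rewrite !ren_tm_sub.
- by move=> G A iA B iB D r; rewrite iA iB.
- by move=> G a A iA D r; rewrite iA ren_up_sub.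
Qed.

Lemma sub_up_comp (G D K : ctx) a (r : sub G D) (s : sub D K) :
  sub_comp (@sub_up _ _ a r) (sub_up s) = sub_up (sub_comp r s).
Proof.
apply: sub_ext; apply: var_cons => //= b y.
rewrite /sub_comp /sub_up /= !ren_tm_sub !sub_tm_comp; apply: eq_sub_tm => c x.
by rewrite /sub_comp /= ren_tm_sub.
Qed.

Lemma sub_fm_comp (G D K : ctx) (r : sub G D) (s : sub D K) (A : fm G) :
  sub_fm s (sub_fm r A) = sub_fm (sub_comp r s) A.
Proof.
elim: A D K r s => //= {G}.
- by move=> G s t D K r s'; rewrite !sub_tm_comp.
- by move=> G s t D K r s'; rewrite !sub_tm_comp.
- by move=> G A iA B iB D K r s; rewrite iA iB.
- by move=> G a A iA D K r s; rewrite iA sub_up_comp.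
Qed.

Lemma sub_up_id (G : ctx) a : sub_up (@sub_id G) = @sub_id (a :: G).
Proof. by apply: sub_ext; apply: var_cons. Qed.

Lemma sub_fm_id (G : ctx) (A : fm G) : sub_fm sub_id A = A.
Proof.
elim: A => //= {G}.
- by move=> G s t; rewrite !sub_tm_id.
- by move=> G s t; rewrite !sub_tm_id.
- by move=> G A -> B ->.
- by move=> G a A iA; rewrite sub_up_id iA.
Qed.

Definition shift_fm (G : ctx) a (A : fm G) : fm (a :: G) := ren_fm ren_shift A.
Definition shift_tm (G : ctx) a b (t : tm G b) : tm (a :: G) b := ren_tm ren_shift t.
Definition shift_sub (G D : ctx) a (r : sub G D) : sub G (a :: D) :=
  fun b x => shift_tm a (r b x).

Lemma shift_sub_fm (G D : ctx) a (r : sub G D) (A : fm G) :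
  shift_fm a (sub_fm r A) = sub_fm (shift_sub a r) A.
Proof.
rewrite /shift_fm ren_fm_sub sub_fm_comp; apply: eq_sub_fm => b x.
by rewrite /shift_sub /shift_tm ren_tm_sub.
Qed.

Lemma sub_up_cons (G D K : ctx) a (r : sub G D) (t : tm K a) (s : sub D K) :
  sub_comp (sub_up r) (sub_cons t s) = sub_cons t (sub_comp r s).
Proof.
apply: sub_ext; apply: var_cons => //= b y.
by rewrite /sub_comp /sub_up /= ren_tm_sub sub_tm_comp; apply: eq_sub_tm.
Qed.

Lemma sub_comp_id_r (G D : ctx) (r : sub G D) : sub_comp r sub_id = r.
Proof. by apply: sub_ext => a x; rewrite /sub_comp sub_tm_id. Qed.

Lemma inst_sub_up (G D : ctx) a (r : sub G D) (A : fm (a :: G)) (t : tm D a) :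
  inst (sub_fm (sub_up r) A) t = sub_fm (sub_cons t r) A.
Proof. by rewrite /inst sub_fm_comp sub_up_cons sub_comp_id_r. Qed.

Lemma sub_lift1 (G D : ctx) a b (r : sub G D) (u : tm D a) (t : tm G b) :
  sub_tm (sub_cons u r) (lift [a] t) = sub_tm r t.
Proof. by rewrite /lift ren_tm_sub sub_tm_comp; apply: eq_sub_tm. Qed.

Lemma sub_eq_ty (G D : ctx) (r : sub G D) a (s t : tm G a) :
  sub_fm r (eq_ty s t) = eq_ty (sub_tm r s) (sub_tm r t).
Proof.
elim: a G D r s t => [//|a _ b ib] G D r s t /=.
have E u : sub_tm (sub_up r) (lift [a] u) = lift [a] (sub_tm r (u : tm G (a ~> b))).
  rewrite /lift !ren_tm_sub !sub_tm_comp; apply: eq_sub_tm => c x.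
  by rewrite /sub_comp /sub_up /= ren_tm_sub.
by rewrite ib /= !E.
Qed.

(** * Extensional models *)

(** A Henkin structure: [dom (a ~> b)] need not contain all functions. [m_ext] makes pointwise
    [eq_ty] coincide with identity, so equations of higher type can be rewritten. *)
Record model := Model {
  dom : ty -> Type;
  app : forall a b, dom (Arr a b) -> dom a -> dom b;
  m0 : dom Nat;
  m1 : dom Nat;
  madd : dom (Nat ~> Nat ~> Nat);
  mmul : dom (Nat ~> Nat ~> Nat);
  mpi : forall a b, dom (a ~> b ~> a);
  msigma : forall a b c, dom ((a ~> b ~> c) ~> (a ~> b) ~> a ~> c);
  mrec : dom ((Nat ~> Nat ~> Nat) ~> Nat ~> Nat ~> Nat);
  mlt : dom Nat -> dom Nat -> Prop;
  m_ext : forall a b (f g : dom (a ~> b)), (forall x, app f x = app g x) -> f = g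
}.
Arguments mpi {m a b}.
Arguments msigma {m a b c}.
Arguments mrec {m}.
Arguments m0 {m}.
Arguments m1 {m}.
Arguments madd {m}.
Arguments mmul {m}.

Definition env (M : model) (G : ctx) := forall a, var G a -> dom M a.
Definition env_nil (M : model) : env M [] := fun a x =>
  match x in var G a return match G with [] => dom M a | _ => unit end with
  | VZ => tt | VS _ => tt end.
Definition env_cons (M : model) (G : ctx) a (d : dom M a) (e : env M G) :
    env M (a :: G) :=
  fun b x =>
    match x in var G' b'
      return match G' with
             | [] => unit
             | c :: G0 => dom M c -> env M G0 -> dom M b'
             end with
    | VZ => fun d _ => d
    | VS y => fun _ e => e _ y
    end d e.

Fixpoint eval (M : model) (G : ctx) (e : env M G) a (t : tm G a) : dom M a :=
  match t with
  | Var x => e _ x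
  | App s t => app (eval e s) (eval e t)
  | Zero => m0
  | One => m1
  | CAdd => madd
  | CMul => mmul
  | CPi => mpi
  | CSigma => msigma
  | CRec => mrec
  end.

Fixpoint sat (M : model) (G : ctx) (A : fm G) : env M G -> Prop :=
  match A in fm G return env M G -> Prop with
  | Eq s t => fun e => eval e s = eval e t
  | Lt s t => fun e => mlt (eval e s) (eval e t)
  | Bot => fun _ => False
  | Imp A B => fun e => sat A e -> sat B e
  | All a A => fun e => forall d : dom M a, sat A (env_cons d e)
  end.

Lemma env_ext (M : model) (G : ctx) (r s : env M G) :
  (forall a (x : var G a), r a x = s a x) -> r = s.
Proof.
move=> h; apply: functional_extensionality_dep => a.
by apply: functional_extensionality_dep => x; apply: h.
Qed.

Lemma eval_sub (M : model) (G D : ctx) (r : sub G D) (e : env M D) a (t : tm G a) :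
  eval e (sub_tm r t) = eval (fun b x => eval e (r b x)) t.
Proof. by elim: t => //= ? ? s -> t ->. Qed.

Lemma eval_ren (M : model) (G D : ctx) (r : ren G D) (e : env M D) a (t : tm G a) :
  eval e (ren_tm r t) = eval (fun b x => e b (r b x)) t.
Proof. by elim: t => //= ? ? s -> t ->. Qed.

Lemma sat_sub (M : model) (G D : ctx) (r : sub G D) (e : env M D) (A : fm G) :
  sat (sub_fm r A) e <-> sat A (fun b x => eval e (r b x)).
Proof.
elim: A D r e => //= {G}.
- by move=> G s t D r e; rewrite !eval_sub.
- by move=> G s t D r e; rewrite !eval_sub.
- by move=> G A iA B iB D r e; rewrite iA iB.
- move=> G a A iA D r e.
  have E d : (fun b x => eval (env_cons d e) (@sub_up _ _ a r b x)) =
             env_cons d (fun b x => eval e (r b x)).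
    by apply: env_ext; apply: var_cons => //= b y; rewrite /sub_up /= eval_ren.
  by split=> h d; move: (h d); rewrite iA E.
Qed.

(** * Enumeration of formulas *)

Fixpoint ty_eq_dec (a b : ty) : {a = b} + {a <> b}.
Proof. decide equality. Defined.

Lemma in_appl (T : Type) (x : T) l k : In x l -> In x (l ++ k).
Proof. by move=> h; apply: in_or_app; left. Qed.

Lemma in_appr (T : Type) (x : T) l k : In x k -> In x (l ++ k).
Proof. by move=> h; apply: in_or_app; right. Qed.

Lemma in_bind (T U : Type) (f : T -> list U) y x l :
  In x l -> In y (f x) -> In y (flat_map f l).
Proof. by move=> hx hy; apply: (proj2 (in_flat_map _ _ _)); exists x. Qed.

Fixpoint venum (G : ctx) : list {a & var G a} :=
  match G with
  | [] => []
  | a :: G => existT _ a VZ :: map (fun x => existT _ (projT1 x) (VS (projT2 x))) (venum G)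
  end.

Lemma venumP (G : ctx) a (x : var G a) : In (existT _ a x) (venum G).
Proof.
elim: x => [G' b|G' b c x ih] /=; first by left.
by right; apply: (in_map (fun x => existT _ (projT1 x) (VS (projT2 x))) _ _ ih).
Qed.

Fixpoint tyenum (n : nat) : list ty :=
  match n with
  | O => []
  | S n => Nat :: flat_map (fun a => map (Arr a) (tyenum n)) (tyenum n)
  end.
Fixpoint tydepth (a : ty) : nat :=
  match a with Nat => 1%nat | Arr a b => (maxn (tydepth a) (tydepth b)).+1 end.

Lemma tyenumP a n : (tydepth a <= n)%nat -> In a (tyenum n).
Proof.
elim: a n => [|a ia b ib] [|n] //=; first by left.
rewrite ltnS geq_max => /andP[ha hb]; right.
by apply: (in_bind (x:=a)); [apply: ia|apply: in_map; apply: ib].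
Qed.

(** The transport along an equation of types disappears in [ty_inP] because types have decidable
    equality. *)
Definition ty_in (a : ty) (G : ctx) (x : {a & tm G a}) : list (tm G a) :=
  match ty_eq_dec (projT1 x) a with
  | left e => [eq_rect _ (tm G) (projT2 x) _ e]
  | right _ => []
  end.
Lemma ty_inP (a : ty) (G : ctx) (t : tm G a) : In t (ty_in a (existT _ a t)).
Proof.
rewrite /ty_in /=; case: (ty_eq_dec a a) => // e; left.
by rewrite -Eqdep_dec.eq_rect_eq_dec //; apply: ty_eq_dec.
Qed.

Definition terms_at (a : ty) (G : ctx) (l : list {a & tm G a}) : list (tm G a) :=
  flat_map (ty_in a (G:=G)) l.
Lemma terms_atP (a : ty) (G : ctx) (l : list {a & tm G a}) (t : tm G a) :
  In (existT _ a t) l -> In t (terms_at a l).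
Proof. by move=> h; apply: (in_bind h); apply: ty_inP. Qed.

Fixpoint tenum (n : nat) (G : ctx) : list {a & tm G a} :=
  match n with
  | O => []
  | S n =>
    let T := tyenum n in
    map (fun x => existT _ (projT1 x) (Var (projT2 x))) (venum G) ++
    flat_map (fun a => map (fun b => existT (tm G) _ (CPi (rho:=a) (tau:=b))) T) T ++
    flat_map (fun a => flat_map (fun b => map (fun c =>
      existT (tm G) _ (CSigma (rho:=a) (sigma:=b) (tau:=c))) T) T) T ++
    flat_map (fun a => flat_map (fun b => flat_map (fun s => map (fun t =>
      existT (tm G) _ (App s t)) (terms_at a (tenum n G)))
      (terms_at (a ~> b) (tenum n G))) T) T ++
    [existT _ _ Zero; existT _ _ One; existT _ _ CAdd; existT _ _ CMul;
     existT _ _ CRec]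
  end.

Definition max3 a b c := maxn a (maxn b c).
Fixpoint tdepth (G : ctx) a (t : tm G a) : nat :=
  match t with
  | @App _ a b s t => (maxn (max3 (tydepth a) (tydepth b) (tdepth s)) (tdepth t)).+1
  | @CPi _ a b => (maxn (tydepth a) (tydepth b)).+1
  | @CSigma _ a b c => (max3 (tydepth a) (tydepth b) (tydepth c)).+1
  | _ => 1%nat
  end.

Lemma tenumP (G : ctx) a (t : tm G a) n : (tdepth t <= n)%nat -> In (existT _ a t) (tenum n G).
Proof.
elim: t n => [a' x|a' b s ihs t iht| | | | |a' b|a' b c| ] [|n] //= hn.
- apply: in_appl.
  exact: (in_map (fun x => existT _ (projT1 x) (Var (projT2 x))) _ _ (venumP x)).
- do 3 apply: in_appr; apply: in_appl.
  move: hn; rewrite ltnS /max3 !geq_max => /andP[/andP[ha /andP[hb hs]] ht].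
  apply: (in_bind (x:=a')); first exact: tyenumP.
  apply: (in_bind (x:=b)); first exact: tyenumP.
  apply: (in_bind (x:=s)); first by apply/terms_atP/ihs.
  by apply: (in_map (fun t => existT (tm G) _ (App s t))); apply/terms_atP/iht.
- by do 4 apply: in_appr; left.
- by do 4 apply: in_appr; do 1 right; left.
- by do 4 apply: in_appr; do 2 right; left.
- by do 4 apply: in_appr; do 3 right; left.
- apply: in_appr; apply: in_appl.
  move: hn; rewrite ltnS geq_max => /andP[ha hb].
  apply: (in_bind (x:=a')); first exact: tyenumP.
  apply: (in_map (fun b => existT (tm G) _ (CPi (rho:=a') (tau:=b)))); exact: tyenumP.
- do 2 apply: in_appr; apply: in_appl.
  move: hn; rewrite ltnS /max3 !geq_max => /andP[ha /andP[hb hc]].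
  apply: (in_bind (x:=a')); first exact: tyenumP.
  apply: (in_bind (x:=b)); first exact: tyenumP.
  apply: (in_map (fun c => existT (tm G) _ (CSigma (rho:=a') (sigma:=b) (tau:=c)))); exact: tyenumP.
- by do 4 apply: in_appr; do 4 right; left.
Qed.

(** Each stage of the Henkin construction appends such a finite list, for its own context, to its
    queue. The bound on depth replaces a numbering of all formulas and is invariant under renaming
    ([fdepth_ren]). *)
Fixpoint fenum (n : nat) (G : ctx) : list (fm G) :=
  match n with
  | O => []
  | S n =>
    let N := terms_at Nat (tenum n G) in
    Bot ::
    flat_map (fun s => map (Eq s) N) N ++
    flat_map (fun s => map (Lt s) N) N ++
    flat_map (fun A => map (Imp A) (fenum n G)) (fenum n G) ++
    flat_map (fun a => map (All a) (fenum n (a :: G))) (tyenum n)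
  end.
Fixpoint fdepth (G : ctx) (A : fm G) : nat :=
  match A with
  | Eq s t | Lt s t => (maxn (tdepth s) (tdepth t)).+1
  | Bot => 1%nat
  | Imp A B => (maxn (fdepth A) (fdepth B)).+1
  | All a A => (maxn (tydepth a) (fdepth A)).+1
  end.

Lemma fenumP (G : ctx) (A : fm G) n : (fdepth A <= n)%nat -> In A (fenum n G).
Proof.
elim: A n => {G} [G s t|G s t|G|G A iA B iB|G a A iA] [|n] //=.
- rewrite ltnS geq_max => /andP[hs ht]; right; apply: in_appl.
  apply: (in_bind (x:=s)); first exact/terms_atP/tenumP.
  by apply: in_map; apply/terms_atP/tenumP.
- rewrite ltnS geq_max => /andP[hs ht]; right.
  apply: in_appr; apply: in_appl.
  apply: (in_bind (x:=s)); first exact/terms_atP/tenumP.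
  by apply: in_map; apply/terms_atP/tenumP.
- by left.
- rewrite ltnS geq_max => /andP[hs ht]; right.
  do 2 (apply: in_appr); apply: in_appl.
  apply: (in_bind (x:=A)); first exact: iA.
  by apply: in_map; apply: iB.
- rewrite ltnS geq_max => /andP[hs ht]; right.
  do 3 (apply: in_appr).
  apply: (in_bind (x:=a)); first exact: tyenumP.
  by apply: in_map; apply: iA.
Qed.

Lemma tdepth_ren (G D : ctx) (r : ren G D) a (t : tm G a) : tdepth (ren_tm r t) = tdepth t.
Proof. by elim: t => //= ? ? s -> t ->. Qed.

Lemma fdepth_ren (G D : ctx) (r : ren G D) (A : fm G) : fdepth (ren_fm r A) = fdepth A.
Proof.
elim: A D r => //= {G}.
- by move=> G s t D r; rewrite !tdepth_ren.
- by move=> G s t D r; rewrite !tdepth_ren.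
- by move=> G A iA B iB D r; rewrite iA iB.
- by move=> G a A iA D r; rewrite iA.
Qed.

(** * Henkin construction *)

Definition consistent (T : theory) (G : ctx) (H : list (fm G)) : Prop :=
  derives T H Bot -> False.

(* A stage of the construction: the variables of [sctx] are the Henkin constants so far,
   [shyp] is the finite set of accepted formulas, and the queue [squeue] holds the formulas
   that are still to be decided. *)
Record stage := Stage { sctx : ctx; shyp : list (fm sctx); squeue : list (fm sctx) }.

(** For a formula that is not universal the default is a dummy variable with the derivable formula
    [Not Bot], so that every step adds exactly one variable. *)
Definition witness (G : ctx) (A : fm G) : {a & fm (a :: G)} :=
  match A in fm G return {a & fm (a :: G)} with
  | All a B => existT _ a (Not B)
  | _ => existT _ Nat (Not Bot)
  end.

Definition pending (s : stage) : fm (sctx s) := hd Bot (squeue s).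

(* Decides the first formula [A] of the queue and adds one new variable; when [~ A] is
   accepted and [A] is universal, that variable is a counterexample to [A]. *)
Definition step (T : theory) (n : nat) (s : stage) : stage :=
  let A := pending s in
  let w := witness A in
  let c := excluded_middle_informative (consistent T (A :: shyp s)) in
  Stage (sctx := projT1 w :: sctx s)
    ((if c then [] else [projT2 w]) ++
     map (shift_fm (projT1 w)) ((if c then A else Not A) :: shyp s))
    (map (shift_fm (projT1 w)) (tl (squeue s)) ++ fenum n _).

(** Every type has a term, zero or a constant function, so the quantifier can be instantiated. Hence
    a fresh variable does not destroy consistency. *)
Lemma derives_bot_inhab (T : theory) (G : ctx) (H : list (fm G)) a :
  derives T H (All a Bot) -> derives T H Bot.
Proof.
suff [t]: inhabited (tm G a) by move=> h; have := d_all_elim t h.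
elim: a => [|a _ b [t]]; first exact: (inhabits 0).
by apply: inhabits; apply: (App CPi t).
Qed.

Lemma shift_consistent (T : theory) (G : ctx) (H : list (fm G)) a :
  consistent T H -> consistent T (map (shift_fm a) H).
Proof. by move=> hc h; apply: hc; apply: (derives_bot_inhab (a:=a)); apply: d_all_intro. Qed.

(** If [A] is refuted, [Not A] is derivable and can be added. For [A = All a B], a contradiction
    from [Not B] at the new variable would give [B] by reductio and [All a B] by generalisation,
    against [Not A]. *)
Lemma step_consistent (T : theory) n s :
  consistent T (shyp s) -> consistent T (shyp (step T n s)).
Proof.
move=> hc; rewrite /step /=; set A := pending s.
case: excluded_middle_informative => hA; first exact: (shift_consistent (H:=A :: shyp s)).
have hN : derives T (shyp s) (Not A).
  by apply: d_imp_intro; apply: NNPP => h; apply: hA.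
have hc2 : consistent T (Not A :: shyp s).
  by move=> h; apply: hc; apply: (d_imp_elim _ hN); apply: d_imp_intro.
have triv (B : fm (Nat :: sctx s)) : B = Not Bot ->
    consistent T (B :: map (shift_fm Nat) (Not A :: shyp s)).
  move=> -> h; have := shift_consistent (a:=Nat) hc2; apply.
  by apply: (d_imp_elim (d_imp_intro h)); apply: d_imp_intro; apply: d_hyp; left.
clearbody A; move: hN hc2 triv; case: s A hA {hc} => G Hs Q /= A hA hN hc2 triv.
destruct A; try exact: triv.
move=> h; apply: hc2; apply: (d_imp_elim (A:=All rho A)); first by apply: d_hyp; left.
by apply: d_all_intro; apply: d_raa.
Qed.

Section Henkin.
Variable T : theory.
Variable H0 : list (fm []).
Hypothesis H0_cons : consistent T H0.

Fixpoint stages (n : nat) : stage :=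
  match n with
  | O => Stage H0 []
  | S n => step T n (stages n)
  end.
Definition hctx n := sctx (stages n).
Definition hhyp n : list (fm (hctx n)) := shyp (stages n).
Definition newty n : ty := projT1 (witness (pending (stages n))).

Lemma H_consistent n : consistent T (hhyp n).
Proof. by elim: n => [|n ih] //=; apply: step_consistent. Qed.

Definition shf n (A : fm (hctx n)) : fm (hctx n.+1) := shift_fm (newty n) A.
Definition sht n a (t : tm (hctx n) a) : tm (hctx n.+1) a := shift_tm (newty n) t.

Lemma H_mono n (A : fm (hctx n)) : In A (hhyp n) -> In (shf A) (hhyp n.+1).
Proof.
move=> h; rewrite /hhyp /= ; apply: in_appr; right.
exact: (in_map (shift_fm _)).
Qed.

Lemma H_pending n : In (shf (pending (stages n))) (hhyp n.+1) \/
                    In (shf (Not (pending (stages n)))) (hhyp n.+1).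
Proof.
rewrite /hhyp /=; case: excluded_middle_informative => h; [left|right].
  by left.
by right; left.
Qed.

Definition coh_fm (A : forall n, fm (hctx n)) (n0 : nat) : Prop :=
  forall n, (n0 <= n)%nat -> A n.+1 = shf (A n).

(** Membership in the limit theory. A formula of the limit language is a family that is eventually
    only weakened from one stage to the next. *)
Definition ev_in (A : forall n, fm (hctx n)) : Prop :=
  exists n0, forall n, (n0 <= n)%nat -> In (A n) (hhyp n).

Lemma ev_in1 (A : forall n, fm (hctx n)) n0 n : coh_fm A n0 -> (n0 <= n)%nat ->
  In (A n) (hhyp n) -> ev_in A.
Proof.
move=> hA hn h; exists n => m /subnK <-.
elim: (m - n)%nat => [|k ih] //; rewrite addSn hA; first exact: H_mono.
by apply: leq_trans hn (leq_addl _ _).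
Qed.

(** Each step removes the head of the queue and appends only at its end, so the number of formulas
    in front of [A], on which the induction runs, drops by one. *)
Lemma queue_pending (A : forall n, fm (hctx n)) n0 n : coh_fm A n0 -> (n0 <= n)%nat ->
  In (A n) (squeue (stages n)) ->
  exists m, (n <= m)%nat /\ exists q, squeue (stages m) = A m :: q.
Proof.
move=> hA hn h; have [l [r]] := in_split _ _ h; clear h.
have [k hk] : exists k, length l = k by exists (length l).
revert n hn l r hk; induction k as [|k ih]; move=> n hn l r hk e.
  by case: l hk e => // _ e; exists n; split=> //; exists r.
case: l hk e => // B l /= [hk] e.
have [| |m [hm [q hq]]] := ih n.+1 (leqW hn) (map (shf (n:=n)) l)
  (map (shf (n:=n)) r ++ fenum n (hctx n.+1)).
- by rewrite length_map.
- by rewrite /= e /= map_app -app_assoc hA.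
by exists m; split; [apply: ltnW|exists q].
Qed.

Lemma fdepth_shf n (A : fm (hctx n)) : fdepth (shf A) = fdepth A.
Proof. exact: fdepth_ren. Qed.

(** Shifting preserves depth, so a step whose number is at least the depth puts the formula into the
    queue. *)
Lemma reached (A : forall n, fm (hctx n)) n0 : coh_fm A n0 ->
  exists n, (n0 <= n)%nat /\ pending (stages n) = A n.
Proof.
move=> hA; pose n := maxn n0 (fdepth (A n0)).
have hd k : fdepth (A (k + n0)%nat) = fdepth (A n0).
  by elim: k => // k ih; rewrite addSn hA ?leq_addl // fdepth_shf.
have hn : (n0 <= n)%nat by apply: leq_maxl.
have hq : In (A n.+1) (squeue (stages n.+1)).
  rewrite /=; apply: in_appr; apply: fenumP; rewrite hA // fdepth_shf.
  by rewrite -(subnK hn) hd subnK //; apply: leq_maxr.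
have [m [hm [q e]]] := queue_pending hA (leqW hn) hq.
exists m; split; last by rewrite /pending e.
by apply: leq_trans hn (ltnW hm).
Qed.

Definition notf (A : forall n, fm (hctx n)) n : fm (hctx n) := Not (A n).

Lemma coh_notf A n0 : coh_fm A n0 -> coh_fm (notf A) n0.
Proof. by move=> h n hn; rewrite /notf h. Qed.

Lemma ev_dec A n0 : coh_fm A n0 -> ev_in A \/ ev_in (notf A).
Proof.
move=> hA; have [n [hn e]] := reached hA; have hn' := leqW hn.
have [] := H_pending n; rewrite e => h; [left|right].
  by apply: (ev_in1 hA hn'); rewrite hA.
by apply: (ev_in1 (coh_notf hA) hn'); rewrite /notf hA.
Qed.

Lemma ev_cons A : ev_in A -> ev_in (notf A) -> False.
Proof.
move=> [n0 h0] [n1 h1]; apply: (@H_consistent (maxn n0 n1)).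
apply: (d_imp_elim (A:=A (maxn n0 n1))); apply: d_hyp.
  by apply: h1; apply: leq_maxr.
by apply: h0; apply: leq_maxl.
Qed.

(** Otherwise the limit theory would contain the negation by [ev_dec], and a late stage would be
    inconsistent. *)
Lemma ev_close A n0 n1 : coh_fm A n0 ->
  (forall n, (n1 <= n)%nat -> derives T (hhyp n) (A n)) -> ev_in A.
Proof.
move=> hA hd; have [//|[n2 h2]] := ev_dec hA.
case: (@H_consistent (maxn n1 n2)).
apply: (d_imp_elim (A:=A (maxn n1 n2))); last by apply: hd; apply: leq_maxl.
by apply: d_hyp; apply: h2; apply: leq_maxr.
Qed.

(* An element of the term model is an eventually coherent family of terms, one for each
   stage, so that elements born at different stages need no transport along contexts. *)
Definition germ a := forall n, tm (hctx n) a.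
Definition coh a (e : germ a) : Prop :=
  exists n0, forall n, (n0 <= n)%nat -> e n.+1 = sht (e n).

Definition genv (G : ctx) := forall n, sub G (hctx n).
Definition cohs (G : ctx) (r : genv G) n0 : Prop :=
  forall n, (n0 <= n)%nat -> r n.+1 = shift_sub (newty n) (r n).
Definition gcons (G : ctx) a (e : germ a) (r : genv G) : genv (a :: G) :=
  fun n => sub_cons (e n) (r n).

Lemma cohs_cons (G : ctx) a (e : germ a) (r : genv G) :
  coh e -> (exists n0, cohs r n0) -> exists n0, cohs (gcons e r) n0.
Proof.
move=> [n0 h0] [n1 h1]; exists (maxn n0 n1) => n; rewrite geq_max => /andP[hn0 hn1].
by apply: sub_ext; apply: var_cons => [|b y]; rewrite /gcons /= /shift_sub /= ?h0 ?h1.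
Qed.

Definition geval (G : ctx) (r : genv G) a (t : tm G a) : germ a := fun n => sub_tm (r n) t.
Definition inst_fm (G : ctx) (r : genv G) (A : fm G) : forall n, fm (hctx n) :=
  fun n => sub_fm (r n) A.
Definition holds (G : ctx) (A : fm G) (r : genv G) : Prop := ev_in (inst_fm r A).

Lemma coh_inst (G : ctx) (r : genv G) (A : fm G) n0 : cohs r n0 -> coh_fm (inst_fm r A) n0.
Proof. by move=> h n hn; rewrite /inst_fm h // /shf shift_sub_fm. Qed.

Lemma holds_imp (G : ctx) (A B : fm G) (r : genv G) : (exists n0, cohs r n0) ->
  holds (A --> B) r <-> (holds A r -> holds B r).
Proof.
move=> [n0 hr]; split.
  move=> [n1 h1] [n2 h2]; apply: (ev_close (n0:=n0) (n1:=maxn n1 n2)).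
    exact: coh_inst.
  move=> n; rewrite geq_max => /andP[hn1 hn2].
  by apply: (d_imp_elim (A:=sub_fm (r n) A)); apply: d_hyp; [apply: h1|apply: h2].
move=> h; have [hA|[n1 hA]] := ev_dec (coh_inst A hr).
  have [n1 hB] := h hA; apply: (ev_close (n0:=n0) (n1:=n1)); first exact: coh_inst.
  by move=> n hn; apply: d_imp_intro; apply: d_hyp; right; apply: hB.
apply: (ev_close (n0:=n0) (n1:=n1)); first exact: coh_inst.
move=> n hn; apply: d_imp_intro; apply: d_raa.
apply: (d_imp_elim (A:=sub_fm (r n) A)); apply: d_hyp; last by right; left.
by right; right; apply: hA.
Qed.

(** The induction moves the whole family [X] by one index, which avoids transport along equations
    between stages; entries before [n] are filled with the junk [d]. *)
Lemma extend_seq (X : nat -> Type) (f : forall n, X n -> X n.+1) (d : forall n, X n) n (t : X n) :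
  exists e : forall n, X n, e n = t /\ forall m, (n <= m)%nat -> e m.+1 = f m (e m).
Proof.
elim: n X f d t => [|n ih] X f d t.
  by exists (nat_rect X t f).
have [e [e1 e2]] := ih (fun n => X n.+1) (fun n => f n.+1) (fun n => d n.+1) t.
exists (fun n => match n with O => d 0%nat | S n => e n end); split=> //.
by case=> // m hm; apply: e2.
Qed.

Lemma germ_at n a (t : tm (hctx n) a) : exists e : germ a,
  e n = t /\ forall m, (n <= m)%nat -> e m.+1 = sht (e m).
Proof.
have inh m : tm (hctx m) a.
  by elim: a {t} => [|a _ b t]; [exact: Zero|exact: (App CPi t)].
exact: (extend_seq (fun m => sht (n:=m) (a:=a)) inh t).
Qed.

(** The term [t] is the newest variable, whose type is [a] only after rewriting with the equation on
    [pending]; the existential hides this. *)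
Lemma step_witness n s a (B : fm (a :: sctx s)) : pending s = All a B ->
  (In (shift_fm _ (All a B)) (shyp (step T n s))) \/
  exists t : tm (sctx (step T n s)) a,
    In (Not (sub_fm (sub_cons t (shift_sub _ sub_id)) B)) (shyp (step T n s)).
Proof.
rewrite /step /=; move: (pending s) => A e; subst A => /=.
case: excluded_middle_informative => h; first by left; left.
right; exists (Var VZ); left; congr Not.
rewrite -[LHS]sub_fm_id; apply: eq_sub_fm; exact: var_cons.
Qed.

(** From right to left, the universal formula is pending at some stage. Either it is accepted there,
    or the new variable, continued to a germ, is a counterexample and contradicts the hypothesis at
    that germ. *)
Lemma holds_all (G : ctx) a (A : fm (a :: G)) (r : genv G) : (exists n0, cohs r n0) ->
  holds (All a A) r <-> forall e, coh e -> holds A (gcons e r).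
Proof.
move=> hr'; have [n0 hr] := hr'; split.
  move=> [n1 h1] e he; have [n2 h2] := cohs_cons he hr'.
  apply: (ev_close (n0:=n2) (n1:=n1)); first exact: coh_inst.
  move=> n hn; rewrite /inst_fm /gcons -inst_sub_up.
  by apply: d_all_elim; apply: d_hyp; apply: h1.
move=> h; have hc := coh_inst (All a A) hr.
have [n [hn e]] := reached hc.
have [hi|[t ht]] := step_witness n e.
  by apply: (ev_in1 hc (leqW hn)); rewrite hc // /inst_fm; exact: hi.
have [g [g1 g2]] := germ_at (n:=n.+1) t.
have hg : coh g by exists n.+1.
have [n2 h2] := h _ hg.
(* The counterexample found at stage [n.+1] is carried to all later stages. *)
have hk m : (n.+1 <= m)%nat -> In (Not (sub_fm (gcons g r m) A)) (hhyp m).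
  move=> /subnK <-; elim: (m - n.+1)%nat => [|k ih].
    rewrite add0n /gcons g1 hr //; move: ht.
    rewrite sub_fm_comp /= sub_up_cons.
    have -> // : sub_comp (r n) (shift_sub (newty n) sub_id) = shift_sub (newty n) (r n).
    apply: sub_ext => b x; rewrite /sub_comp /shift_sub /shift_tm ren_tm_sub.
    exact: eq_sub_tm.
  rewrite addSn; have := H_mono ih; rewrite /shf /shift_fm.
  have -> // : ren_fm ren_shift (Not (sub_fm (gcons g r (k + n.+1)%nat) A)) =
    Not (sub_fm (gcons g r (k + n.+1).+1) A).
  rewrite /= -/(shift_fm _ _) shift_sub_fm; congr Not; apply: eq_sub_fm.
  have hnk : (n0 <= k + n.+1)%nat by apply: leq_trans hn _; apply: leq_trans (leqnSn _) (leq_addl _ _).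
  by apply: var_cons => [|b x]; rewrite /gcons /= /shift_sub /= ?g2 ?leq_addl ?hr.
case: (ev_cons (A:=inst_fm (gcons g r) A)); first by exists n2.
by exists n.+1.
Qed.

(** * Equality of germs *)

Lemma inst_eq_lift (G : ctx) (s t : tm G Nat) : inst (Eq v0 (lift [Nat] s)) t = Eq t s.
Proof. by rewrite /inst /= sub_lift1 sub_tm_id. Qed.

Lemma derives_eq_sym (G : ctx) (K : list (fm G)) s t :
  derives T K (Eq s t) -> derives T K (Eq t s).
Proof.
move=> h; have := d_eq_subst (A:=Eq v0 (lift [Nat] s)) h.
by rewrite !inst_eq_lift; apply; apply: d_eq_refl.
Qed.

Lemma derives_eq_trans (G : ctx) (K : list (fm G)) s t u :
  derives T K (Eq s t) -> derives T K (Eq t u) -> derives T K (Eq s u).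
Proof.
move=> h1 h2; have := d_eq_subst (A:=Eq v0 (lift [Nat] u)) (derives_eq_sym h1).
by rewrite !inst_eq_lift; apply.
Qed.

Lemma derives_lt_subst (G : ctx) (K : list (fm G)) s t s' t' :
  derives T K (Eq s s') -> derives T K (Eq t t') ->
  derives T K (Lt s t) -> derives T K (Lt s' t').
Proof.
move=> h1 h2 h; have := d_eq_subst (A:=Lt (lift [Nat] s') v0) h2.
rewrite /inst /= !sub_lift1 !sub_tm_id; apply.
by have := d_eq_subst (A:=Lt v0 (lift [Nat] t)) h1; rewrite /inst /= !sub_lift1 !sub_tm_id; apply.
Qed.

(** At every type this is the truth of [eq_ty] in the limit theory ([holds_eq_ty]); dividing by it
    makes the term model extensional. *)
Fixpoint germ_eq (a : ty) : germ a -> germ a -> Prop :=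
  match a with
  | Nat => fun x y => ev_in (fun n => Eq (x n) (y n))
  | Arr a b => fun f g => forall e : germ a, coh e ->
      germ_eq (fun n => App (f n) (e n)) (fun n => App (g n) (e n))
  end.

Lemma coh_app a b (f : germ (a ~> b)) (e : germ a) : coh f -> coh e ->
  coh (fun n => App (f n) (e n)).
Proof.
move=> [n0 h0] [n1 h1]; exists (maxn n0 n1) => n; rewrite geq_max => /andP[hn0 hn1].
by rewrite h0 // h1.
Qed.

Lemma coh_fm2 a b (f : forall G, tm G a -> tm G b -> fm G) (x : germ a) (y : germ b) :
  (forall G D (r : ren G D) s t, ren_fm r (f G s t) = f D (ren_tm r s) (ren_tm r t)) ->
  coh x -> coh y -> exists n0, coh_fm (fun n => f _ (x n) (y n)) n0.
Proof.
move=> hf [n0 h0] [n1 h1]; exists (maxn n0 n1) => n; rewrite geq_max => /andP[hn0 hn1].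
by rewrite h0 // h1 // /shf /shift_fm hf.
Qed.

Lemma coh_eq (x y : germ Nat) : coh x -> coh y -> exists n0, coh_fm (fun n => Eq (x n) (y n)) n0.
Proof. exact: (coh_fm2 (f:=Eq)). Qed.

Lemma coh_lt (x y : germ Nat) : coh x -> coh y -> exists n0, coh_fm (fun n => Lt (x n) (y n)) n0.
Proof. exact: (coh_fm2 (f:=Lt)). Qed.

Lemma R_refl a (x : germ a) : coh x -> germ_eq x x.
Proof.
elim: a x => [|a _ b ib] x hx /=; last by move=> e he; apply: ib; apply: coh_app.
have [n0 h] := coh_eq hx hx; apply: (ev_close (n1:=0%nat) h) => n _; exact: d_eq_refl.
Qed.

Lemma R_sym a (x y : germ a) : coh x -> coh y -> germ_eq x y -> germ_eq y x.
Proof.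
elim: a x y => [|a _ b ib] x y hx hy /= h.
  have [n0 hc] := coh_eq hy hx; have [n1 h1] := h.
  apply: (ev_close (n1:=n1) hc) => n hn.
  by apply: derives_eq_sym; apply: d_hyp; apply: h1.
by move=> e he; apply: ib; try apply: coh_app => //; apply: h.
Qed.

Lemma R_trans a (x y z : germ a) : coh x -> coh y -> coh z -> germ_eq x y -> germ_eq y z -> germ_eq x z.
Proof.
elim: a x y z => [|a _ b ib] x y z hx hy hz /= h h'.
  have [n0 hc] := coh_eq hx hz; have [n1 h1] := h; have [n2 h2] := h'.
  apply: (ev_close (n1:=maxn n1 n2) hc) => n; rewrite geq_max => /andP[hn1 hn2].
  by apply: (derives_eq_trans (t:=y n)); apply: d_hyp; [apply: h1|apply: h2].
move=> e he; apply: (ib _ (fun n => App (y n) (e n))); try exact: coh_app.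
  exact: h.
exact: h'.
Qed.

Lemma holds_eq_ty a (G : ctx) (s t : tm G a) (r : genv G) : (exists n0, cohs r n0) ->
  holds (eq_ty s t) r <-> germ_eq (geval r s) (geval r t).
Proof.
elim: a G s t r => [|a _ b ib] G s t r hr //=.
rewrite holds_all //; split=> h e he; move: (h e he);
  rewrite (ib _ _ _ _ (cohs_cons he hr)) /geval /=;
  suff E u : (fun n => App (sub_tm (gcons e r n) (lift [a] u)) (e n)) =
    (fun n => App (sub_tm (r n) (u : tm G (a ~> b))) (e n)) by rewrite !E.
- by apply: functional_extensionality_dep => n; rewrite sub_lift1.
- by apply: functional_extensionality_dep => n; rewrite sub_lift1.
Qed.

Hypothesis T_stable : forall (G D : ctx) (r : sub G D) A, T A -> T (sub_fm r A).
Hypothesis T_ext : forall (G : ctx) a b, T (G:=G)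
  (All a (All a (All (a ~> b) (eq_ty v2 v1 --> eq_ty (v0 @ v2) (v0 @ v1))))).

Lemma holds_T (G : ctx) (A : fm G) (r : genv G) : T A -> (exists n0, cohs r n0) -> holds A r.
Proof.
move=> hA [n0 hr]; apply: (ev_close (coh_inst _ hr) (n1:=0%nat)) => n _.
by apply: d_ax; apply: T_stable.
Qed.

Definition gnil : genv [] := fun n a x =>
  match x in var G a return match G with [] => tm (hctx n) a | _ => unit end with
  | VZ => tt | VS _ => tt end.

Lemma sub_nil_uniq (D : ctx) (r s : sub [] D) : r = s.
Proof.
apply: sub_ext => a x.
by refine (match x in var G _ return match G with [] => _ | _ => True end with VZ => I | VS _ => I end).
Qed.

Lemma cohs_nil : exists n0, cohs gnil n0.
Proof. by exists 0%nat => n _; apply: sub_nil_uniq. Qed.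

(** Congruence in the function holds by definition of [germ_eq]; congruence in the argument comes
    from the extensionality axiom. *)
Lemma R_ext a b (f : germ (a ~> b)) (x y : germ a) : coh f -> coh x -> coh y ->
  germ_eq x y -> germ_eq (fun n => App (f n) (x n)) (fun n => App (f n) (y n)).
Proof.
move=> hf hx hy; have c0 := cohs_nil.
have c1 := cohs_cons hx c0; have c2 := cohs_cons hy c1; have c3 := cohs_cons hf c2.
have := holds_T (T_ext [] a b) c0.
rewrite holds_all // => /(_ x hx); rewrite holds_all // => /(_ y hy).
rewrite holds_all // => /(_ f hf); rewrite holds_imp //.
by rewrite !holds_eq_ty.
Qed.

(** * The term model and its truth lemma *)

Definition cls a (e : germ a) : germ a -> Prop := fun y => coh y /\ germ_eq e y.

Lemma cls_eq a (x y : germ a) : coh x -> coh y -> germ_eq x y -> cls x = cls y.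
Proof.
move=> hx hy h; apply: functional_extensionality => z.
apply: propositional_extensionality; split=> -[hz h']; split=> //.
  by apply: (R_trans (y:=x)) => //; apply: R_sym.
exact: (R_trans (y:=y)).
Qed.

Lemma cls_inj a (x y : germ a) : coh x -> coh y -> cls x = cls y -> germ_eq x y.
Proof.
move=> hx hy h; have : cls y y by split=> //; apply: R_refl.
by rewrite -h => -[].
Qed.

(** The quotient consists of equivalence classes as predicates, so that equivalent germs give equal
    elements. *)
Definition tdom (a : ty) : Type := {P : germ a -> Prop | exists e, coh e /\ P = cls e}.

Definition mk a (e : germ a) (he : coh e) : tdom a :=
  exist _ (cls e) (ex_intro _ e (conj he erefl)).
Definition rep a (d : tdom a) : germ a :=
  proj1_sig (constructive_indefinite_description _ (proj2_sig d)).
Lemma rep_coh a (d : tdom a) : coh (rep d).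
Proof. by rewrite /rep; case: constructive_indefinite_description => e []. Qed.

Lemma rep_cls a (d : tdom a) : proj1_sig d = cls (rep d).
Proof. by rewrite /rep; case: constructive_indefinite_description => e []. Qed.

Lemma tdom_eq a (d d' : tdom a) : proj1_sig d = proj1_sig d' -> d = d'.
Proof.
case: d d' => [P hP] [Q hQ] /= e; move: hQ; rewrite -e => hQ.
by rewrite (proof_irrelevance _ hP hQ).
Qed.

Lemma rep_mk a (e : germ a) (he : coh e) : germ_eq (rep (mk he)) e.
Proof.
apply: cls_inj => //; first exact: rep_coh.
by rewrite -rep_cls.
Qed.

Definition tapp a b (f : tdom (a ~> b)) (x : tdom a) : tdom b :=
  mk (coh_app (rep_coh f) (rep_coh x)).

Definition const_germ a (t : forall G, tm G a) : germ a := fun n => t (hctx n).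
Lemma coh_const a (t : forall G, tm G a) :
  (forall G D (r : ren G D), ren_tm r (t G) = t D) -> coh (const_germ t).
Proof. by move=> h; exists 0%nat => n _; rewrite /const_germ /sht /shift_tm h. Qed.

Lemma tapp_mk a b (f : germ (a ~> b)) (x : germ a) (hf : coh f) (hx : coh x) :
  tapp (mk hf) (mk hx) = mk (coh_app hf hx).
Proof.
apply: tdom_eq => /=; apply: cls_eq; try by apply: coh_app => //; apply: rep_coh.
apply: (R_trans (y:=fun n => App (f n) (rep (mk hx) n)));
  try by apply: coh_app => //; apply: rep_coh.
- have h := rep_mk hf; exact: (h _ (rep_coh (mk hx))).
- by apply: R_ext => //; [apply: rep_coh|apply: rep_mk].
Qed.

Lemma mk_rep a (d : tdom a) : d = mk (rep_coh d).
Proof. by apply: tdom_eq; rewrite rep_cls. Qed.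

Lemma mk_eq a (x y : germ a) (hx : coh x) (hy : coh y) : germ_eq x y <-> mk hx = mk hy.
Proof.
split=> [h|h]; first by apply: tdom_eq; apply: cls_eq.
by apply: cls_inj => //; apply: (f_equal (@proj1_sig _ _) h).
Qed.

Lemma tdom_ext a b (f g : tdom (a ~> b)) : (forall x, tapp f x = tapp g x) -> f = g.
Proof.
move=> h; rewrite (mk_rep f) (mk_rep g); apply/mk_eq => e he.
by have := h (mk he); rewrite {1}(mk_rep f) {1}(mk_rep g) !tapp_mk => /mk_eq.
Qed.

Definition tmodel : model :=
  Model (dom:=tdom) (app:=tapp)
    (mk (coh_const (t:=fun G => Zero) (fun _ _ _ => erefl)))
    (mk (coh_const (t:=fun G => One) (fun _ _ _ => erefl)))
    (mk (coh_const (t:=fun G => CAdd) (fun _ _ _ => erefl)))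
    (mk (coh_const (t:=fun G => CMul) (fun _ _ _ => erefl)))
    (fun a b => mk (coh_const (t:=fun G => @CPi G a b) (fun _ _ _ => erefl)))
    (fun a b c => mk (coh_const (t:=fun G => @CSigma G a b c) (fun _ _ _ => erefl)))
    (mk (coh_const (t:=fun G => CRec) (fun _ _ _ => erefl)))
    (fun x y => ev_in (fun n => Lt (rep x n) (rep y n)))
    tdom_ext.

Definition tracks (G : ctx) (v : env tmodel G) (r : genv G) : Prop :=
  forall a (x : var G a), exists h : coh (fun n => r n a x), v a x = mk h.

Lemma eval_tracks (G : ctx) (v : env tmodel G) (r : genv G) a (t : tm G a) : tracks v r ->
  exists h : coh (geval r t), eval v t = mk h.
Proof.
move=> hv; elim: t => /= [b x|b c s [hs ->] t [ht ->]|||||||]; first exact: hv;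
  try by eexists.
by exists (coh_app hs ht); rewrite tapp_mk.
Qed.

(** The truth lemma. Since [mlt] is defined through chosen representatives, the case of [Lt]
    substitutes accepted equations between these and the given germs. *)
Lemma sat_tracks (G : ctx) (A : fm G) (v : env tmodel G) (r : genv G) :
  (exists n0, cohs r n0) -> tracks v r -> sat A v <-> holds A r.
Proof.
elim: A v r => {G} [G s t|G s t|G|G A iA B iB|G a A iA] v r hr hv.
- have [hs es] := eval_tracks s hv; have [ht et] := eval_tracks t hv.
  by rewrite /= es et -mk_eq.
- have [hs es] := eval_tracks s hv; have [ht et] := eval_tracks t hv.
  rewrite /= es et; have R1 := rep_mk hs; have R2 := rep_mk ht.
  have R1' := R_sym (rep_coh _) hs R1; have R2' := R_sym (rep_coh _) ht R2.
  move: R1 R2 R1' R2' => [n1 h1] [n2 h2] [n3 h3] [n4 h4].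
  split=> -[n5 h5].
    have [n0 hc] := coh_lt hs ht.
    apply: (ev_close (n1:=maxn n1 (maxn n2 n5)) hc) => n.
    rewrite !geq_max => /andP[k1 /andP[k2 k5]].
    by apply: (derives_lt_subst (s:=rep (mk hs) n) (t:=rep (mk ht) n)); apply: d_hyp; auto.
  have [n0 hc] := coh_lt (rep_coh (mk hs)) (rep_coh (mk ht)).
  apply: (ev_close (n1:=maxn n3 (maxn n4 n5)) hc) => n.
  rewrite !geq_max => /andP[k1 /andP[k2 k5]].
  by apply: (derives_lt_subst (s:=geval r s n) (t:=geval r t n)); apply: d_hyp; auto.
- split=> // -[n0 h]; apply: (@H_consistent n0).
  by apply: d_hyp; apply: h.
- by rewrite holds_imp //= (iA v r) // (iB v r).
- rewrite holds_all //=; split=> h.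
    move=> e he; rewrite -(iA (env_cons (M:=tmodel) (mk he) v)); first exact: h.
      exact: cohs_cons.
    by apply: var_cons; [exists he|move=> b x; apply: hv].
  move=> d; rewrite (mk_rep d) (iA _ (gcons (rep d) r)).
  + by apply: h; apply: rep_coh.
  + by apply: cohs_cons => //; apply: rep_coh.
  + by apply: var_cons; [exists (rep_coh d)|move=> b x; apply: hv].
Qed.

Lemma tracks_all (G : ctx) (v : env tmodel G) : exists r, (exists n0, cohs r n0) /\ tracks v r.
Proof.
elim: G v => [|a G ih] v.
  exists gnil; split; first exact: cohs_nil.
  move=> a x.
  by refine (match x in var G _ return match G with [] => _ | _ => True end with VZ => I | VS _ => I end).
have [r [hr hv]] := ih (fun b x => v b (VS x)).
exists (gcons (rep (v _ VZ)) r); split; first by apply: cohs_cons => //; apply: rep_coh.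
apply: var_cons; last by move=> b x; apply: hv.
by exists (rep_coh (v _ VZ)); rewrite -mk_rep.
Qed.

Lemma tmodel_T (G : ctx) (A : fm G) (v : env tmodel G) : T A -> sat A v.
Proof. by move=> hA; have [r [hr hv]] := tracks_all v; rewrite (sat_tracks _ hr hv); apply: holds_T. Qed.

Lemma tmodel_H0 A : In A H0 -> sat A (env_nil tmodel).
Proof.
move=> hA; rewrite (sat_tracks _ cohs_nil); last first.
  by have [r [hr hv]] := tracks_all (env_nil tmodel); move=> a x; have := hv a x;
     have -> : r = gnil by apply: functional_extensionality_dep => n; apply: sub_nil_uniq.
apply: (ev_in1 (n0:=0%nat) (n:=0%nat)) => //.
  move=> n _; rewrite /inst_fm /shf shift_sub_fm; apply: eq_sub_fm => a x.
  by rewrite (sub_nil_uniq (gnil n.+1) (shift_sub _ (gnil n))).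
by rewrite /inst_fm (sub_nil_uniq (gnil 0%nat) sub_id) sub_fm_id.
Qed.
End Henkin.

(** If [A] has no derivation, [Not A] is consistent by reductio, and the term model built from it
    satisfies the theory and refutes [A]. Closure under substitution lets axioms be instantiated by
    germs; the extensionality axioms make application well defined on classes. *)
Theorem completeness (T : theory) (A : fm []) :
  (forall (G D : ctx) (r : sub G D) B, T G B -> T D (sub_fm r B)) ->
  (forall (G : ctx) a b, T G
    (All a (All a (All (a ~> b) (eq_ty v2 v1 --> eq_ty (v0 @ v2) (v0 @ v1)))))) ->
  (forall M : model, (forall G (B : fm G) (e : env M G), T G B -> sat B e) ->
    sat A (env_nil M)) ->
  provable T A.
Proof.
move=> st ex hM; apply: d_raa; apply: NNPP => hc.
have h := hM (tmodel hc st ex) (fun G B e => tmodel_T e).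
by apply: (tmodel_H0 hc st ex (A:=Not A)); [left|].
Qed.

(** * Arithmetic in a model *)

Lemma qf_sub (G D : ctx) (r : sub G D) (A : fm G) :
  quantifier_free A -> quantifier_free (sub_fm r A).
Proof.
elim: A D r => //= {G} G A iA B iB D r [hA hB].
by split; [apply: iA|apply: iB].
Qed.

(** Substituting into an instance of a scheme gives the instance for the substituted formula. The
    work lies in induction and choice, whose statements contain substitutions that have to be
    commuted with the given one. *)
Lemma RCA0w_stable (G D : ctx) (r : sub G D) (A : fm G) : RCA0w A -> RCA0w (sub_fm r A).
Proof.
move=> h; case: h D r => {G A} G; try by [move=> D r; constructor].
- move=> a b D r; rewrite /= sub_eq_ty; exact: ax_Pi.
- move=> a b c D r; rewrite /= sub_eq_ty; exact: ax_Sigma.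
- move=> a b D r; rewrite /= !sub_eq_ty; exact: ax_ext.
- move=> A hA D r /=; set A' := sub_fm (sub_up r) A.
  have -> : sub_fm r (inst A 0) = inst A' 0.
    by rewrite inst_sub_up /inst sub_fm_comp; apply: eq_sub_fm; exact: var_cons.
  have -> : sub_fm (sub_up r) (sub_fm (sub_cons (v0 + 1) (fun a x => Var (VS x))) A) =
            sub_fm (sub_cons (v0 + 1) (fun a x => Var (VS x))) A'.
    rewrite !sub_fm_comp; apply: eq_sub_fm; apply: var_cons => //= b y.
    by rewrite /sub_comp /sub_up /= !ren_tm_sub !sub_tm_comp; apply: eq_sub_tm.
  by apply: ax_qf_ind; apply: qf_sub.
- move=> A hA D r /=; have := ax_qf_ac (qf_sub (sub_up (sub_up r)) hA).
  rewrite /Ex /Not /= !sub_fm_comp.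
  set r1 := sub_comp (sub_up _) _; set r2 := sub_comp (sub_cons _ _) _.
  have -> // : r1 = r2.
  apply: sub_ext; apply: var_cons => //=; apply: var_cons => //= b y.
  by rewrite /r1 /r2 /sub_comp /sub_up /= !ren_tm_sub !sub_tm_comp; apply: eq_sub_tm.
Qed.

Lemma ACA0w_stable (G D : ctx) (r : sub G D) (A : fm G) : ACA0w A -> ACA0w (sub_fm r A).
Proof.
move=> h; case: h D r => {G A} G; last by move=> D r; exact: aca_exists2.
by move=> A hA D r; apply: aca_rca; apply: RCA0w_stable.
Qed.

(** * Meaning of the derived connectives *)

Lemma sat_not M G (A : fm G) (e : env M G) : sat (Not A) e <-> ~ (sat A e)%type.
Proof. by []. Qed.

Lemma sat_all M G a (A : fm (a :: G)) (e : env M G) :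
  sat (All a A) e <-> forall d : dom M a, sat A (env_cons d e).
Proof. by []. Qed.

Lemma sat_imp M G (A B : fm G) (e : env M G) : sat (Imp A B) e <-> (sat A e -> sat B e).
Proof. by []. Qed.

Lemma sat_and M G (A B : fm G) (e : env M G) : sat (And A B) e <-> (sat A e /\ sat B e).
Proof.
split=> [h|[hA hB] h]; last exact: (h hA hB).
by split; apply: NNPP => hn; apply: h => hA // hB; apply: hn.
Qed.

Lemma sat_or M G (A B : fm G) (e : env M G) : sat (Or A B) e <-> (sat A e \/ sat B e).
Proof.
split=> [h|[hA|hB] h //]; last by case: (h hA).
by case: (excluded_middle_informative (sat A e)) => hA; [left|right; apply: h].
Qed.

Lemma sat_iff M G (A B : fm G) (e : env M G) : sat (Iff A B) e <-> (sat A e <-> sat B e).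
Proof. by rewrite /Iff sat_and /=; split=> [[h1 h2]|[h1 h2]]; split. Qed.

Lemma sat_ex M G a (A : fm (a :: G)) (e : env M G) :
  sat (Ex a A) e <-> exists d : dom M a, sat A (env_cons d e).
Proof.
split=> [h|[d hd] h]; last exact: (h d hd).
by apply: NNPP => hn; apply: h => d hd; apply: hn; exists d.
Qed.

Lemma sat_eq_ty M a G (s t : tm G a) (e : env M G) :
  sat (eq_ty s t) e <-> eval e s = eval e t.
Proof.
elim: a G s t e => [//|a _ b ib] G s t e /=.
have E d (u : tm G (a ~> b)) : eval (env_cons d e) (lift [a] u) = eval e u.
  by rewrite /lift eval_ren.
split=> [h|h d]; last by rewrite ib /= !E h.
by apply: m_ext => d; have := h d; rewrite ib /= !E.
Qed.

Record aca := Aca {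
  aM :> model;
  acaP : forall G (B : fm G) (e : env aM G), ACA0w B -> sat B e
}.

Declare Scope model_scope.
Delimit Scope model_scope with mod.
Local Notation "x + y" := (app (app madd x) y) : model_scope.
Local Notation "x * y" := (app (app mmul x) y) : model_scope.
Local Notation "0" := m0 : model_scope.
Local Notation "1" := m1 : model_scope.
Local Notation "x < y" := (mlt x y) : model_scope.
Local Notation "e ;; d" := (env_cons d e) (at level 52, left associativity).
Local Open Scope model_scope.

(** * Semiring and order laws from quantifier-free induction *)

Section Arith.
Variable M : aca.
Local Notation N := (dom M Nat).
Local Notation E0 := (env_nil M).

Lemma rcaP G (B : fm G) (e : env M G) : RCA0w B -> sat B e.
Proof. by move=> h; apply: acaP; apply: aca_rca. Qed.

Lemma qf_induction G (A : fm (Nat :: G)) (e : env M G) : quantifier_free A ->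
  sat A (env_cons 0 e) ->
  (forall n, sat A (env_cons n e) -> sat A (env_cons (n + 1) e)) ->
  forall n, sat A (env_cons n e).
Proof.
move=> qA h0 hS; have /= := rcaP e (ax_qf_ind qA); apply.
  rewrite /inst sat_sub.
  have -> // : (fun b x => eval e (sub_cons 0%tm sub_id x)) = env_cons m0 e.
  by apply: env_ext; apply: var_cons.
move=> n hn; rewrite sat_sub; have := hS n hn; congr sat.
by apply: env_ext; apply: var_cons.
Qed.

Lemma succ_nz (x : N) : x + 1 <> 0.
Proof. exact: (rcaP E0 (ax_succ_nonzero _) x). Qed.

Lemma succ_inj (x y : N) : x + 1 = y + 1 -> x = y.
Proof. exact: (rcaP E0 (ax_succ_inj _) x y). Qed.

Lemma maddn0 (x : N) : x + 0 = x.
Proof. exact: (rcaP E0 (ax_add_zero _) x). Qed.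

Lemma maddnS (x y : N) : x + (y + 1) = x + y + 1.
Proof. exact: (rcaP E0 (ax_add_succ _) x y). Qed.

Lemma mmuln0 (x : N) : x * 0 = 0.
Proof. exact: (rcaP E0 (ax_mul_zero _) x). Qed.

Lemma mmulnS (x y : N) : x * (y + 1) = x * y + x.
Proof. exact: (rcaP E0 (ax_mul_succ _) x y). Qed.

Lemma mltn0 (x : N) : (x < 0) -> False.
Proof. exact: (rcaP E0 (ax_lt_zero _) x). Qed.

Lemma mltnS (x y : N) : (x < y + 1) <-> (x < y \/ x = y).
Proof.
have h : sat (v1 < v0 + One <-> (v1 < v0 \/ v1 == v0))%fm (E0 ;; x ;; y) :=
  rcaP E0 (ax_lt_succ _) x y.
by move: h; rewrite sat_iff sat_or.
Qed.

Lemma pi_app a b (x : dom M a) (y : dom M b) : app (app mpi x) y = x.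
Proof. 
have h : sat (eq_ty (CPi @ v1 @ v0) v1) (E0 ;; x ;; y) := rcaP E0 (ax_Pi _ a b) x y.
by move: h; rewrite sat_eq_ty. Qed.

Lemma sigma_app a b c (x : dom M (a ~> b ~> c)) (y : dom M (a ~> b)) (z : dom M a) :
  app (app (app msigma x) y) z = app (app x z) (app y z).
Proof. 
have h : sat (eq_ty (CSigma @ v2 @ v1 @ v0) (v2 @ v0 @ (v1 @ v0))) (E0 ;; x ;; y ;; z) :=
  rcaP E0 (ax_Sigma _ a b c) x y z.
by move: h; rewrite sat_eq_ty. Qed.

Lemma rec0 (g : dom M (Nat ~> Nat ~> Nat)) (x : N) : app (app (app mrec g) x) 0 = x.
Proof. exact: (rcaP E0 (ax_rec_zero _) g x). Qed.

Lemma recS (g : dom M (Nat ~> Nat ~> Nat)) (x y : N) :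
  app (app (app mrec g) x) (y + 1) = app (app g y) (app (app (app mrec g) x) y).
Proof. exact: (rcaP E0 (ax_rec_succ _) g x y). Qed.

Lemma madd0n (x : N) : 0 + x = x.
Proof.
apply: (qf_induction (A:=(Zero + v0 == v0)%fm) (e:=E0)) => //=; first by rewrite maddn0.
by move=> n; rewrite maddnS => ->.
Qed.

Lemma one_succ : 1 = 0 + 1 :> N.
Proof. by rewrite madd0n. Qed.

Lemma maddA (x y z : N) : x + (y + z) = x + y + z.
Proof.
apply: (qf_induction (A:=(v2 + (v1 + v0) == v2 + v1 + v0)%fm) (e:=E0 ;; x ;; y)) => //=.
  by rewrite !maddn0.
by move=> n; rewrite !maddnS => ->.
Qed.

Lemma maddSn (x y : N) : x + 1 + y = x + y + 1.
Proof.
apply: (qf_induction (A:=(v1 + One + v0 == v1 + v0 + One)%fm) (e:=E0 ;; x)) => //=.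
  by rewrite !maddn0.
by move=> n; rewrite !maddnS => ->.
Qed.

Lemma maddC (x y : N) : x + y = y + x.
Proof.
apply: (qf_induction (A:=(v1 + v0 == v0 + v1)%fm) (e:=E0 ;; x)) => //=.
  by rewrite maddn0 madd0n.
by move=> n; rewrite maddnS maddSn => ->.
Qed.

Lemma mmul0n (x : N) : 0 * x = 0.
Proof.
apply: (qf_induction (A:=(Zero * v0 == Zero)%fm) (e:=E0)) => //=; first by rewrite mmuln0.
by move=> n; rewrite mmulnS maddn0.
Qed.

Lemma maddAC (x y z : N) : x + y + z = x + z + y.
Proof. by rewrite -!maddA (maddC y). Qed.

Lemma mmulSn (x y : N) : (x + 1) * y = x * y + y.
Proof.
apply: (qf_induction (A:=((v1 + One) * v0 == v1 * v0 + v0)%fm) (e:=E0 ;; x)) => //=.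
  by rewrite !mmuln0 maddn0.
by move=> n; rewrite !mmulnS => ->; rewrite !maddnS (maddAC _ x n).
Qed.

Lemma mmulC (x y : N) : x * y = y * x.
Proof.
apply: (qf_induction (A:=(v1 * v0 == v0 * v1)%fm) (e:=E0 ;; x)) => //=.
  by rewrite mmuln0 mmul0n.
by move=> n; rewrite mmulnS mmulSn => ->.
Qed.

Lemma mmulDl (x y z : N) : (x + y) * z = x * z + y * z.
Proof.
apply: (qf_induction (A:=((v2 + v1) * v0 == v2 * v0 + v1 * v0)%fm) (e:=E0 ;; x ;; y)) => //=.
  by rewrite !mmuln0 maddn0.
by move=> n; rewrite !mmulnS => ->; rewrite !maddA -!(maddAC _ x).
Qed.

Lemma mmulA (x y z : N) : x * (y * z) = x * y * z.
Proof.
apply: (qf_induction (A:=(v2 * (v1 * v0) == v2 * v1 * v0)%fm) (e:=E0 ;; x ;; y)) => //=.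
  by rewrite !mmuln0.
by move=> n h; rewrite !mmulnS -h (mmulC x) mmulDl !(mmulC _ x).
Qed.

Lemma mmul1n (x : N) : 1 * x = x.
Proof. by rewrite one_succ mmulSn mmul0n madd0n. Qed.

Lemma maddI (x y z : N) : x + z = y + z -> x = y.
Proof.
apply: (qf_induction (A:=(v2 + v0 == v1 + v0 --> v2 == v1)%fm) (e:=E0 ;; x ;; y)) => //=.
  by rewrite !maddn0.
by move=> n h; rewrite !maddnS => /succ_inj.
Qed.

Lemma mlt_trans (x y z : N) : x < y -> y < z -> x < z.
Proof.
move=> h; apply: (qf_induction (A:=(v1 < v0 --> v2 < v0)%fm) (e:=E0 ;; x ;; y)) => //=.
  by move=> /mltn0.
by move=> n h'; rewrite !mltnS => -[/h'|e]; left => //; rewrite -e.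
Qed.

Lemma mlt0S (x : N) : 0 < x + 1.
Proof.
apply: (qf_induction (A:=(Zero < v0 + One)%fm) (e:=E0)) => //=; first by rewrite mltnS; right.
by move=> n h; rewrite mltnS; left.
Qed.

Lemma mltSS (x y : N) : x < y -> x + 1 < y + 1.
Proof.
apply: (qf_induction (A:=(v1 < v0 --> v1 + One < v0 + One)%fm) (e:=E0 ;; x)) => //=.
  by move=> /mltn0.
by move=> n h; rewrite mltnS => -[/h h'|->]; rewrite mltnS; [left|right].
Qed.

(** To be proved by quantifier-free induction, the existential is made explicit by the predecessor,
    the recursion whose step [CPi] returns the counter. *)
Lemma mcase (x : N) : x = 0 \/ exists y, x = y + 1.
Proof.
pose p := app (app (app mrec mpi) 0) x : N.
have e : x = 0 \/ x = p + 1.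
  suff : sat (v0 == Zero \/ v0 == CRec @ CPi @ Zero @ v0 + One)%fm (E0 ;; x).
    by rewrite sat_or.
  apply: qf_induction => //; first by rewrite sat_or; left.
  move=> n _; rewrite sat_or /=; right.
  by rewrite recS pi_app.
by case: e => [e|e]; [left|right; exists p].
Qed.

Lemma mlt_total (x y : N) : x < y \/ x = y \/ y < x.
Proof.
suff : sat (v0 < v1 \/ v0 == v1 \/ v1 < v0)%fm (E0 ;; y ;; x) by rewrite !sat_or.
apply: qf_induction => //.
  by rewrite !sat_or /=; case: (mcase y) => [->|[z ->]]; [right; left|left; apply: mlt0S].
move=> n; rewrite !sat_or /= => -[h|[->|h]].
- by have := mltSS h; rewrite mltnS => -[]; [left|right; left].
- by right; right; rewrite mltnS; right.
- by right; right; rewrite mltnS; left.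
Qed.

Lemma neqS (x : N) : x <> x + 1.
Proof.
apply: (qf_induction (A:=(~ v0 == v0 + One)%fm) (e:=E0)) => //=.
  by rewrite -one_succ => e; apply: (@succ_nz 0); rewrite -one_succ.
by move=> n h /succ_inj.
Qed.

Lemma mlt_irr (x : N) : ~ (x < x)%mod.
Proof.
apply: (qf_induction (A:=(~ v0 < v0)%fm) (e:=E0)) => //=; first exact: mltn0.
move=> n h; rewrite mltnS => -[h'|/esym/neqS //]; apply: h.
by apply: mlt_trans h'; rewrite mltnS; right.
Qed.

(** Truncated subtraction, by iterating the predecessor. It provides differences without an
    existential, and it turns [<] into an equation with zero, as [chi] requires. *)
Definition nsub {G} : tm G (Nat ~> Nat ~> Nat) := CRec @ (CPi @ (CRec @ CPi @ Zero)).
Definition msub (x y : N) : N := app (app (eval E0 nsub) x) y.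
Definition mpred (x : N) := eval (E0 ;; x) (CRec @ CPi @ Zero @ v0)%tm.
Lemma msubS x y : msub x (y + 1) = mpred (msub x y).
Proof. by rewrite /msub /= recS pi_app. Qed.

Lemma mpred0 : mpred 0 = 0.
Proof. by rewrite /mpred /= rec0. Qed.

Lemma mpredS x : mpred (x + 1) = x.
Proof. by rewrite /mpred /= recS pi_app. Qed.

Lemma maddIn_eq0 (x y : N) : x + y = x -> y = 0.
Proof. by rewrite maddC -[X in _ = X -> _]madd0n => /maddI. Qed.

Lemma mltS (x : N) : x < x + 1.
Proof. by rewrite mltnS; right. Qed.

Lemma msubnKC x y : x < y + 1 -> x + msub y x = y.
Proof.
apply: (qf_induction (A:=(v0 < v1 + One --> v0 + nsub @ v1 @ v0 == v1)%fm) (e:=E0 ;; y)) => //=.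
  by rewrite rec0 madd0n.
rewrite -!/(msub _ _) => n h h1.
have h2 : n < y by have := h1; rewrite mltnS => -[|<-]; [apply: mlt_trans; apply: mltS|apply: mltS].
have h3 := h (mlt_trans h2 (mltS y)).
change (n + 1 + msub y (n + 1) = y); rewrite msubS.
case: (mcase (msub y n)) => [e|[z e]].
  by move: h2; rewrite -h3 -/(msub y n) e maddn0 => /mlt_irr.
by rewrite e mpredS maddSn -maddnS -e.
Qed.

Lemma msubnn x : msub x x = 0.
Proof. by apply: (@maddIn_eq0 x); apply: msubnKC; apply: mltS. Qed.

Lemma msubn_eq0 x y : msub x y = 0 <-> (x < y + 1).
Proof.
split=> [e|].
  case: (mlt_total x y) => [h|[->|h]]; first exact: mlt_trans h (mltS y).
    exact: mltS.
  have := msubnKC (mlt_trans h (mltS x)); rewrite e maddn0 => e'.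
  by move: h; rewrite e' => /mlt_irr.
apply: (qf_induction (A:=(v1 < v0 + One --> nsub @ v1 @ v0 == Zero)%fm) (e:=E0 ;; x)) => //=.
  by rewrite mltnS => -[/mltn0 //|->]; rewrite rec0.
move=> n h; rewrite mltnS => -[/h h1|->]; last exact: msubnn.
by change (msub x (n + 1) = 0); rewrite msubS; change (mpred (msub x n) = 0 :> N);
   rewrite /msub /= h1 mpred0.
Qed.

Lemma mlt_diff (x y : N) : x < y -> exists z, y = x + z + 1.
Proof.
move=> h; have e := msubnKC (mlt_trans h (mltS y)).
case: (mcase (msub y x)) => [e0|[z ez]].
  by move: h; rewrite -e e0 maddn0 => /mlt_irr.
by exists z; rewrite -maddnS -ez.
Qed.

Lemma mmuln_eq0 (x y : N) : x * y = 0 -> x = 0 \/ y = 0.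
Proof.
case: (mcase y) => [->|[z ->]]; first by right.
rewrite mmulnS; case: (mcase x) => [->|[w ->]]; first by left.
by rewrite maddnS => /succ_nz.
Qed.
End Arith.

(** * Arithmetical comprehension *)

(** The combinator S K K. With it [lam] is the usual bracket abstraction, which supplies lambda
    terms in a language of combinators. *)
Definition comb_I {G} (a : ty) : tm G (a ~> a) :=
  CSigma @ CPi @ (CPi : tm G (a ~> a ~> a)).

Definition lam_var (G : ctx) a b (x : var (a :: G) b) : tm G (a ~> b) :=
  match x in var G' b' return match G' with [] => unit | c :: G0 => tm G0 (c ~> b') end with
  | VZ => comb_I _
  | VS y => CPi @ Var y
  end.

Fixpoint lam (G : ctx) a b (t : tm (a :: G) b) : tm G (a ~> b) :=
  match t with
  | Var x => lam_var x
  | App s t => CSigma @ lam s @ lam t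
  | Zero => CPi @ Zero
  | One => CPi @ One
  | CAdd => CPi @ CAdd
  | CMul => CPi @ CMul
  | CPi => CPi @ CPi
  | CSigma => CPi @ CSigma
  | CRec => CPi @ CRec
  end.

Lemma eval_lam (M : aca) (G : ctx) a b (t : tm (a :: G) b) (e : env M G) (d : dom M a) :
  app (eval e (lam t)) d = eval (e ;; d) t.
Proof.
elim: t => [c x|b' c s ihs t iht| | | | |? ?|? ? ?|] /=; rewrite ?pi_app ?sigma_app ?ihs ?iht //.
by move: c x; apply: var_cons => [|c y] /=; rewrite ?sigma_app pi_app.
Qed.

(** Negation, for truth values in which zero means true. *)
Definition isz (G : ctx) (x : tm G Nat) : tm G Nat :=
  CRec @ (CPi @ (CPi @ Zero)) @ One @ x.

Lemma isz0 (M : aca) (G : ctx) (e : env M G) (t : tm G Nat) : eval e t = 0 -> eval e (isz t) = 1.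
Proof. by move=> h; rewrite /= h rec0. Qed.

Lemma iszS (M : aca) (G : ctx) (e : env M G) (t : tm G Nat) : eval e t <> 0 -> eval e (isz t) = 0.
Proof. by case: (mcase (eval e t)) => // -[y hy] _; rewrite /= hy recS !pi_app. Qed.

Lemma one_nz (M : aca) : 1 <> 0 :> dom M Nat.
Proof. by rewrite one_succ; apply: succ_nz. Qed.

Lemma isz_eq0 (M : aca) (G : ctx) (e : env M G) (t : tm G Nat) :
  eval e (isz t) = 0 <-> eval e t <> 0.
Proof.
split; last exact: iszS.
by move=> h /isz0; rewrite h => /esym/one_nz.
Qed.

Fixpoint arith (G : ctx) (A : fm G) : Prop :=
  match A with
  | Imp A B => arith A /\ arith B
  | All a A => match a with Nat => arith A | _ => False end
  | _ => True
  end.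

(* The term [chi A E] is zero exactly when [A] holds, provided [E] witnesses [exists^2];
   quantifiers over higher types get a junk value. *)
Fixpoint chi (G : ctx) (A : fm G) : tm G ty2 -> tm G Nat :=
  match A in fm G return tm G ty2 -> tm G Nat with
  | Eq s t => fun _ => (nsub @ s @ t + nsub @ t @ s)%tm
  | Lt s t => fun _ => nsub @ (s + One)%tm @ t
  | Bot => fun _ => One
  | Imp A B => fun E => (isz (chi A E) * chi B E)%tm
  | @All G a A => fun E =>
      match a return tm G (a ~> Nat) -> tm G Nat with
      | Nat => fun t => isz (E @ t)
      | _ => fun _ => Zero
      end (lam (isz (chi A (lift [a] E))))
  end.

Definition exists2_spec (M : aca) (E : dom M ty2) : Prop :=
  forall f, app E f = 0 <-> exists n, app f n = 0.

Lemma maddn_eq0 (M : aca) (x y : dom M Nat) : x + y = 0 <-> x = 0 /\ y = 0.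
Proof.
split=> [|[-> ->]]; last by rewrite maddn0.
case: (mcase y) => [->|[z ->]]; first by rewrite maddn0.
by rewrite maddnS => /succ_nz.
Qed.

Lemma chiP (M : aca) (G : ctx) (A : fm G) (e : env M G) (E : tm G ty2) :
  arith A -> exists2_spec (eval e E) -> sat A e <-> eval e (chi A E) = 0.
Proof.
elim: A e E => {G} [G s t|G s t|G|G A iA B iB|G a A iA] e E hA hE.
- change (eval e s = eval e t <-> msub (eval e s) (eval e t) + msub (eval e t) (eval e s) = 0).
  rewrite maddn_eq0 !msubn_eq0; split=> [->|[]]; first by split; apply: mltS.
  by rewrite !mltnS => -[h|//] [h'|//]; case: (mlt_irr (mlt_trans h h')).
- change (mlt (eval e s) (eval e t) <-> msub (eval e s + 1) (eval e t) = 0).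
  rewrite msubn_eq0; split; first exact: mltSS.
  by rewrite mltnS => -[|<-]; [apply: mlt_trans; apply: mltS|apply: mltS].
- by split=> // /one_nz.
- have {}iA := iA e E (proj1 hA) hE; have {}iB := iB e E (proj2 hA) hE.
  change ((sat A e -> sat B e) <-> eval e (isz (chi A E)) * eval e (chi B E) = 0).
  rewrite iA iB; split.
    case: (excluded_middle_informative (eval e (chi A E) = 0)) => h.
      by move=> /(_ h) ->; rewrite mmuln0.
    by move=> _; rewrite (iszS h) mmul0n.
  by move=> h h0; move: h; rewrite (isz0 h0) mmul1n.
(* [E] is asked for a zero of the negated characteristic function, that is, for a counterexample;
   the outer [isz] negates the answer. *)
- case: a A iA hA => // A iA hA.
  have hE' d : exists2_spec (eval (e ;; d) (lift [Nat] E)).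
    by rewrite /lift eval_ren.
  change ((forall d, sat A (e ;; d)) <-> eval e (isz (E @ lam (isz (chi A (lift [Nat] E))))) = 0).
  rewrite isz_eq0; change (eval e (E @ _)%tm) with
    (app (eval e E) (eval e (lam (isz (chi A (lift [Nat] E)))))); rewrite hE; split.
    move=> h [n]; rewrite eval_lam isz_eq0; apply.
    by rewrite -iA.
  move=> h d; rewrite (iA _ _ hA (hE' d)); apply: NNPP => hn; apply: h.
  by exists d; rewrite eval_lam isz_eq0.
Qed.

Lemma aca_exists2E (M : aca) : exists E : dom M ty2, exists2_spec E.
Proof.
have := acaP (env_nil M) (aca_exists2 []); rewrite sat_ex => -[E]; rewrite sat_all => hE; exists E => f.
by move: (hE f); rewrite sat_and sat_iff sat_ex => -[_].
Qed.

Lemma arith_ren (G D : ctx) (r : ren G D) (A : fm G) : arith A -> arith (ren_fm r A).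
Proof.
elim: A D r => //= {G} G; first by move=> A iA B iB D r [hA hB]; split; auto.
by move=> [|//] A iA D r; apply: iA.
Qed.

Lemma comprehension (M : aca) (G : ctx) (A : fm (Nat :: G)) (e : env M G) : arith A ->
  exists c : dom M ty1, forall n, app c n = 0 <-> sat A (e ;; n).
Proof.
move=> hA; have [E hE] := aca_exists2E M.
pose A1 := ren_fm (ren_up (@ren_shift G ty2)) A.
have h1 : arith A1 by apply: arith_ren.
exists (eval (e ;; E) (lam (chi A1 v1))) => n.
rewrite eval_lam -chiP // /A1 ren_fm_sub sat_sub.
have -> // : (fun b x => eval (e ;; E ;; n) (ren_sub (ren_up ren_shift) x)) = e ;; n.
by apply: env_ext; apply: var_cons.
Qed.

(** * The ordered field of fractions *)

Definition natM (M : aca) : Type := dom M Nat.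
HB.instance Definition _ M := gen_eqMixin (natM M).
HB.instance Definition _ M := gen_choiceMixin (natM M).

Lemma one_neq0 (M : aca) : (m1 : natM M) != m0.
Proof. by apply/eqP; apply: one_nz. Qed.

HB.instance Definition _ M :=
  GRing.isNmodule.Build (natM M) (@maddA M) (@maddC M) (@madd0n M).
HB.instance Definition _ M :=
  GRing.Nmodule_isComNzSemiRing.Build (natM M) (@mmulA M) (@mmulC M) (@mmul1n M)
    (@mmulDl M) (@mmul0n M) (@one_neq0 M).

Section Fractions.
Variable M : aca.
Local Notation N := (natM M).
Local Open Scope ring_scope.

Lemma addNI (x y z : N) : x + z = y + z -> x = y.
Proof. exact: maddI. Qed.

Lemma ltN_diff (x y : N) : mlt x y -> exists z, y = x + z + 1.
Proof. exact: mlt_diff. Qed.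

Lemma totN (x y : N) : (exists z, y = x + z + 1) \/ x = y \/ (exists z, x = y + z + 1).
Proof.
case: (@mlt_total M x y) => [/ltN_diff|[|/ltN_diff]]; first by left.
  by right; left.
by right; right.
Qed.

Lemma addN_eq0 (x y : N) : x + y = 0 -> x = 0 /\ y = 0.
Proof. by move/maddn_eq0. Qed.

Lemma mulN_eq0 (x y : N) : x * y = 0 -> x = 0 \/ y = 0.
Proof. exact: mmuln_eq0. Qed.

Lemma succN_nz (x : N) : x + 1 <> 0.
Proof. exact: succ_nz. Qed.

Lemma mulNI (x y z : N) : x * (z + 1) = y * (z + 1) -> x = y.
Proof.
wlog [w ->] : x y / exists w, y = x + w + 1.
  move=> h e; case: (totN x y) => [h'|[//|h']]; first exact: h.
  by apply/esym/h.
move=> e; have : (w + 1) * (z + 1) = 0 :> N.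
  by apply: (@addNI _ _ (x * (z + 1))); rewrite add0r [RHS]e; ring.
by move=> /mulN_eq0[] /succN_nz.
Qed.

(* The triple [(a, b, d)] stands for [(a - b) / (d + 1)]. *)
Definition triple : Type := N * N * N.
Definition trel (p q : triple) : Prop :=
  p.1.1 * (q.2 + 1) + q.1.2 * (p.2 + 1) = q.1.1 * (p.2 + 1) + p.1.2 * (q.2 + 1).
Lemma trel_sym p q : trel p q -> trel q p.
Proof. by rewrite /trel => h; rewrite [RHS]addrC -h addrC. Qed.

Lemma trel_trans p q r : trel p q -> trel q r -> trel p r.
Proof.
case: p q r => [[a b] d] [[a' b'] d'] [[a'' b''] d'']; rewrite /trel /= => h1 h2.
apply: (@mulNI _ _ d').
apply: (@addNI _ _ (a' * (d + 1) * (d'' + 1) + b' * (d + 1) * (d'' + 1))).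
transitivity ((a * (d' + 1) + b' * (d + 1)) * (d'' + 1) +
              (a' * (d'' + 1) + b'' * (d' + 1)) * (d + 1)); first ring.
by rewrite h1 h2; ring.
Qed.

Definition frac_of : Type := {P : triple -> Prop | exists p, P = trel p}.
Definition fpi (p : triple) : frac_of := exist _ (trel p) (ex_intro _ p erefl).
Definition frep (x : frac_of) : triple :=
  proj1_sig (constructive_indefinite_description _ (proj2_sig x)).
Lemma fpiK x : fpi (frep x) = x.
Proof.
rewrite /frep; case: constructive_indefinite_description => p /=.
by case: x => P hP /= e; subst P; congr exist; apply: proof_irrelevance.
Qed.

Lemma fpi_eq p q : fpi p = fpi q <-> trel p q.
Proof.
split=> [h|h].
  have : trel p = trel q by apply: (f_equal (@proj1_sig _ _) h).
  by move=> e; rewrite e.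
have e : trel p = trel q.
  apply: functional_extensionality => r; apply: propositional_extensionality.
  by split; apply: trel_trans => //; apply: trel_sym.
by apply: eq_exist => //.
Qed.

Lemma frep_fpi p : trel (frep (fpi p)) p.
Proof. by apply/fpi_eq; rewrite fpiK. Qed.

Definition tadd (p q : triple) : triple :=
  (p.1.1 * (q.2 + 1) + q.1.1 * (p.2 + 1), p.1.2 * (q.2 + 1) + q.1.2 * (p.2 + 1),
   p.2 * q.2 + p.2 + q.2).
Definition tmul (p q : triple) : triple :=
  (p.1.1 * q.1.1 + p.1.2 * q.1.2, p.1.1 * q.1.2 + p.1.2 * q.1.1,
   p.2 * q.2 + p.2 + q.2).
Definition topp (p : triple) : triple := (p.1.2, p.1.1, p.2).

Lemma tadd_l p p' q : trel p p' -> trel (tadd p q) (tadd p' q).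
Proof.
case: p p' q => [[a b] d] [[a' b'] d'] [[c e] f]; rewrite /trel /= => h.
transitivity ((a * (d' + 1) + b' * (d + 1)) * (f + 1) * (f + 1) +
  (c + e) * (d + 1) * (d' + 1) * (f + 1)); first ring.
by rewrite h; ring.
Qed.

Lemma tmul_l p p' q : trel p p' -> trel (tmul p q) (tmul p' q).
Proof.
case: p p' q => [[a b] d] [[a' b'] d'] [[c e] f]; rewrite /trel /= => h.
transitivity ((f + 1) * (c * (a * (d' + 1) + b' * (d + 1)) +
  e * (a' * (d + 1) + b * (d' + 1)))); first ring.
transitivity ((f + 1) * (c * (a' * (d + 1) + b * (d' + 1)) +
  e * (a * (d' + 1) + b' * (d + 1)))); first by rewrite h.
ring.
Qed.

Lemma taddC p q : trel (tadd p q) (tadd q p).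
Proof. by case: p q => [[a b] d] [[a' b'] d']; rewrite /trel /=; ring. Qed.

Lemma tmulC p q : trel (tmul p q) (tmul q p).
Proof. by case: p q => [[a b] d] [[a' b'] d']; rewrite /trel /=; ring. Qed.

Lemma tadd_c p p' q q' : trel p p' -> trel q q' -> trel (tadd p q) (tadd p' q').
Proof.
move=> h h'; apply: trel_trans (tadd_l _ h) _; apply: trel_trans (taddC _ _) _.
by apply: trel_trans (tadd_l _ h') _; apply: taddC.
Qed.

Lemma tmul_c p p' q q' : trel p p' -> trel q q' -> trel (tmul p q) (tmul p' q').
Proof.
move=> h h'; apply: trel_trans (tmul_l _ h) _; apply: trel_trans (tmulC _ _) _.
by apply: trel_trans (tmul_l _ h') _; apply: tmulC.
Qed.

Lemma topp_c p p' : trel p p' -> trel (topp p) (topp p').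
Proof.
case: p p' => [[a b] d] [[a' b'] d']; rewrite /trel /= => h.
by rewrite addrC -h addrC.
Qed.

Definition fadd x y := fpi (tadd (frep x) (frep y)).
Definition fmul x y := fpi (tmul (frep x) (frep y)).
Definition fopp x := fpi (topp (frep x)).
Lemma faddE p q : fadd (fpi p) (fpi q) = fpi (tadd p q).
Proof. by apply/fpi_eq/tadd_c; apply: frep_fpi. Qed.

Lemma fmulE p q : fmul (fpi p) (fpi q) = fpi (tmul p q).
Proof. by apply/fpi_eq/tmul_c; apply: frep_fpi. Qed.

Lemma foppE p : fopp (fpi p) = fpi (topp p).
Proof. by apply/fpi_eq/topp_c; apply: frep_fpi. Qed.

Definition f0 := fpi (0, 0, 0).
Definition f1 := fpi (1, 0, 0).
Lemma frac_ind (P : frac_of -> Prop) : (forall a b d, P (fpi (a, b, d))) -> forall x, P x.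
Proof. by move=> h x; rewrite -(fpiK x); case: (frep x) => [[a b] d]. Qed.

Lemma faddA : associative fadd.
Proof.
move=> x y z; elim/frac_ind: x => a b d; elim/frac_ind: y => a' b' d'.
elim/frac_ind: z => a'' b'' d''; rewrite !faddE; apply/fpi_eq; rewrite /trel /=; ring.
Qed.

Lemma faddC : commutative fadd.
Proof.
move=> x y; elim/frac_ind: x => a b d; elim/frac_ind: y => a' b' d'.
by rewrite !faddE; apply/fpi_eq/taddC.
Qed.

Lemma fadd0 : left_id f0 fadd.
Proof.
by move=> x; elim/frac_ind: x => a b d; rewrite !faddE; apply/fpi_eq; rewrite /trel /=; ring.
Qed.

Lemma faddN : left_inverse f0 fopp fadd.
Proof.
by move=> x; elim/frac_ind: x => a b d; rewrite foppE faddE; apply/fpi_eq; rewrite /trel /=; ring.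
Qed.

Lemma fmulA : associative fmul.
Proof.
move=> x y z; elim/frac_ind: x => a b d; elim/frac_ind: y => a' b' d'.
elim/frac_ind: z => a'' b'' d''; rewrite !fmulE; apply/fpi_eq; rewrite /trel /=; ring.
Qed.

Lemma fmulC : commutative fmul.
Proof.
move=> x y; elim/frac_ind: x => a b d; elim/frac_ind: y => a' b' d'.
by rewrite !fmulE; apply/fpi_eq/tmulC.
Qed.

Lemma fmul1 : left_id f1 fmul.
Proof.
by move=> x; elim/frac_ind: x => a b d; rewrite !fmulE; apply/fpi_eq; rewrite /trel /=; ring.
Qed.

Lemma fmulD : left_distributive fmul fadd.
Proof.
move=> x y z; elim/frac_ind: x => a b d; elim/frac_ind: y => a' b' d'.
elim/frac_ind: z => a'' b'' d''; rewrite !(fmulE, faddE); apply/fpi_eq; rewrite /trel /=; ring.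
Qed.

Lemma fpi_eq0 a b d : fpi (a, b, d) = f0 <-> a = b.
Proof.
rewrite fpi_eq /trel /=; split=> [h|->]; last ring.
by move: h; rewrite !mul0r !add0r addr0 !mulr1.
Qed.

Lemma f1_neq0 : f1 <> f0.
Proof. by rewrite fpi_eq0; apply/eqP; rewrite oner_neq0. Qed.

(** The value zero at zero is what the field structure demands ([finv0]). *)
Definition finv_spec (x y : frac_of) : Prop :=
  if excluded_middle_informative (x = f0) then y = f0 else fmul y x = f1.
Lemma finv_ex x : exists y, finv_spec x y.
Proof.
rewrite /finv_spec; destruct (excluded_middle_informative (x = f0)) as [e|hx]; first by exists f0.
move: hx; elim/frac_ind: x => a b d hx; case: (totN a b) => [[z e]|[e|[z e]]].
(* Here [a - b = -(z + 1)], so the inverse is [-(d + 1) / (z + 1)]; in the last case the sign is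
   positive. *)
- exists (fpi (0, d + 1, z)); rewrite fmulE; apply/fpi_eq; rewrite /trel /= e; ring.
- by case: hx; apply/fpi_eq0.
- exists (fpi (d + 1, 0, z)); rewrite fmulE; apply/fpi_eq; rewrite /trel /= e; ring.
Qed.

Definition finv x := proj1_sig (constructive_indefinite_description _ (finv_ex x)).
Lemma finvP x : finv_spec x (finv x).
Proof. exact: (proj2_sig (constructive_indefinite_description _ (finv_ex x))). Qed.
End Fractions.

HB.instance Definition _ M := gen_eqMixin (frac_of M).
HB.instance Definition _ M := gen_choiceMixin (frac_of M).
HB.instance Definition _ M :=
  GRing.isZmodule.Build (frac_of M) (@faddA M) (@faddC M) (@fadd0 M) (@faddN M).
Lemma f1_neq (M : aca) : f1 M != f0 M.
Proof. by apply/eqP; apply: f1_neq0. Qed.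

HB.instance Definition _ M :=
  GRing.Zmodule_isComNzRing.Build (frac_of M) (@fmulA M) (@fmulC M) (@fmul1 M) (@fmulD M) (@f1_neq M).
Lemma fmulV (M : aca) (x : frac_of M) : x != 0%R -> (finv x * x = 1)%R.
Proof.
move=> /eqP hx; have := finvP x; rewrite /finv_spec.
by case: excluded_middle_informative.
Qed.

Lemma finv0 (M : aca) : finv (0%R : frac_of M) = 0%R.
Proof.
have := finvP (0%R : frac_of M); rewrite /finv_spec.
by case: excluded_middle_informative.
Qed.

HB.instance Definition _ M := GRing.ComNzRing_isField.Build (frac_of M) (@fmulV M) (@finv0 M).

Section FracOrder.
Variable M : aca.
Local Notation N := (natM M).
Local Notation F := (frac_of M).
Local Open Scope ring_scope.
(** Nonnegativity rather than positivity: [a] may be zero. *)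
Definition fpos (x : F) : Prop := exists a d : N, x = fpi (a, 0, d).
Definition fle (x y : F) : bool := `[< fpos (y - x) >].
Definition flt (x y : F) : bool := (y != x) && fle x y.
Definition fnorm (x : F) : F := if fle 0 x then x else - x.
Lemma fle0P (x : F) : reflect (fpos x) (fle 0 x).
Proof. by rewrite /fle subr0; apply: asboolP. Qed.

Lemma fle0_add (x y : F) : fle 0 x -> fle 0 y -> fle 0 (x + y).
Proof.
move=> /fle0P[a [d ->]] /fle0P[a' [d' ->]]; apply/fle0P.
exists (a * (d' + 1) + a' * (d + 1)), (d * d' + d + d').
by change (fadd (fpi (a, 0, d)) (fpi (a', 0, d')) = fpi (a * (d' + 1) + a' * (d + 1), 0, d * d' + d + d'));
  rewrite faddE; apply/fpi_eq; rewrite /trel /=; ring.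
Qed.

Lemma fle0_mul (x y : F) : fle 0 x -> fle 0 y -> fle 0 (x * y).
Proof.
move=> /fle0P[a [d ->]] /fle0P[a' [d' ->]]; apply/fle0P.
exists (a * a'), (d * d' + d + d').
by change (fmul (fpi (a, 0, d)) (fpi (a', 0, d')) = fpi (a * a', 0, d * d' + d + d'));
  rewrite fmulE; apply/fpi_eq; rewrite /trel /=; ring.
Qed.

Lemma fle0_anti (x : F) : fle 0 x -> fle x 0 -> x = 0.
Proof.
move=> /fle0P[a [d e]] /asboolP; rewrite sub0r => -[a' [d' e']].
have h : fadd (fpi (a, 0, d)) (fpi (a', 0, d')) = f0 M.
  by rewrite -e -e'; exact: (subrr x).
move: h; rewrite faddE fpi_eq0 /= => h.
have [] : a = 0 \/ d' + 1 = 0.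
  by apply: mulN_eq0; apply: (proj1 (addN_eq0 (y:=a' * (d + 1)) _)); rewrite h; ring.
  by move=> a0; rewrite e a0; apply/fpi_eq0.
by move/succN_nz.
Qed.

Lemma fsub_ge0 (x y : F) : fle 0 (y - x) = fle x y.
Proof. by rewrite /fle subr0. Qed.

Lemma fle0_total (x : F) : fle 0 x || fle x 0.
Proof.
apply/orP; rewrite /fle subr0 sub0r; elim/frac_ind: x => a b d.
change (- fpi (a, b, d)) with (fopp (fpi (a, b, d))); rewrite foppE /topp /=.
case: (totN a b) => [[z e]|[e|[z e]]]; [right|left|left]; apply/asboolP.
- by exists (z + 1), d; apply/fpi_eq; rewrite /trel /= e; ring.
- by exists 0, d; apply/fpi_eq; rewrite /trel /= e; ring.
- by exists (z + 1), d; apply/fpi_eq; rewrite /trel /= e; ring.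
Qed.

Lemma fnormN (x : F) : fnorm (- x) = fnorm x.
Proof.
have E (y : F) : fle 0 (- y) = fle y 0 by rewrite /fle subr0 sub0r.
rewrite /fnorm E opprK; case: ifP => h1; case: ifP => h2 //.
  by have := fle0_anti h2 h1 => ->; rewrite oppr0.
by have := fle0_total x; rewrite h1 h2.
Qed.

Lemma fge0_norm (x : F) : fle 0 x -> fnorm x = x.
Proof. by rewrite /fnorm => ->. Qed.

Lemma flt_def (x y : F) : flt x y = (y != x) && fle x y.
Proof. by []. Qed.
End FracOrder.

HB.instance Definition _ M := Num.IntegralDomain_isLeReal.Build (frac_of M)
  (@fle0_add M) (@fle0_mul M) (@fle0_anti M) (@fsub_ge0 M) (@fle0_total M)
  (@fnormN M) (@fge0_norm M) (@flt_def M).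

Section Embedding.
Variable M : aca.
Local Notation N := (natM M).
Local Open Scope ring_scope.
Definition iota (x : dom M Nat) : frac_of M := fpi (M:=M) ((x : N), 0, 0).
Lemma iota0 : iota m0 = 0.
Proof. by []. Qed.

Lemma iota1 : iota m1 = 1.
Proof. by []. Qed.

Lemma iotaD x y : iota (app (app madd x) y) = iota x + iota y.
Proof.
change (fpi (M:=M) ((x : N) + (y : N), 0, 0) = fadd (iota x) (iota y)).
by rewrite faddE; apply/fpi_eq; rewrite /trel /=; ring.
Qed.

Lemma iotaM x y : iota (app (app mmul x) y) = iota x * iota y.
Proof.
change (fpi (M:=M) ((x : N) * (y : N), 0, 0) = fmul (iota x) (iota y)).
by rewrite fmulE; apply/fpi_eq; rewrite /trel /=; ring.
Qed.

Lemma iota_inj : injective iota.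
Proof. by move=> x y /fpi_eq; rewrite /trel /= !mul0r !addr0 !add0r !mulr1. Qed.

Lemma iota_ge0 x : 0 <= iota x.
Proof. by apply/fle0P; exists x, 0. Qed.

Lemma iota_lt x y : mlt x y <-> iota x < iota y.
Proof.
have h a b : mlt a b -> iota a < iota b.
  move=> /mlt_diff[z ->]; rewrite !iotaD iota1; have := iota_ge0 z; lra.
split; first exact: h.
case: (@mlt_total M x y) => [//|[->|/h h']]; first by rewrite ltxx.
by move=> h''; have := lt_trans h' h''; rewrite ltxx.
Qed.

(** This makes the field Archimedean relative to the numbers of [M], even if these are nonstandard;
    see [p2_small]. *)
Lemma fracE (x : frac_of M) : exists a b d, x = (iota a - iota b) / (iota d + 1).
Proof.
elim/frac_ind: x => a b d; exists a, b, d.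
have hd : iota d + 1 != 0 by have := iota_ge0 d; lra.
apply: (mulIf hd); rewrite divfK // -iota1 -iotaD.
change (fmul (fpi (a, b, d)) (iota (app (app madd d) m1)) = fadd (iota a) (fopp (iota b))).
rewrite /iota foppE fmulE faddE; apply/fpi_eq; rewrite /trel /=.
change (app (app madd d) m1) with ((d : N) + 1); ring.
Qed.
End Embedding.

(** * Reals in a model *)

Section Reals.
Variable M : aca.
Local Notation N := (dom M Nat).
Local Notation E0 := (env_nil M).
Local Open Scope ring_scope.
(** From here on the fractions enter only through the properties listed, so that the analysis takes
    place over an abstract ordered field. *)
Variables (F : realFieldType) (iota : N -> F).
Hypothesis iota0 : iota m0 = 0.
Hypothesis iota1 : iota m1 = 1.
Hypothesis iotaD : forall x y, iota (app (app madd x) y) = iota x + iota y.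
Hypothesis iotaM : forall x y, iota (app (app mmul x) y) = iota x * iota y.
Hypothesis iota_inj : injective iota.
Hypothesis iota_ge0 : forall x, 0 <= iota x.
Hypothesis iota_lt : forall x y, mlt x y <-> iota x < iota y.
Hypothesis fracE : forall q, exists a b d, q = (iota a - iota b) / (iota d + 1).

Definition ex2 (n : N) : N := app (eval E0 exp2) n.
Lemma ex2_0 : ex2 m0 = m1.
Proof. by rewrite /ex2 /= rec0. Qed.

Lemma ex2_S n : ex2 (n + 1)%mod = (ex2 n + ex2 n)%mod.
Proof. by rewrite /ex2 /= recS pi_app !sigma_app pi_app. Qed.

Lemma iota_step (x y : N) : mlt x y -> iota x + 1 <= iota y.
Proof. by move=> /mlt_diff[z ->]; rewrite !iotaD iota1; have := iota_ge0 z; lra. Qed.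

Lemma ex2_gt n : mlt n (ex2 n).
Proof.
apply: (qf_induction (A:=(v0 < exp2 @ v0)%fm) (e:=E0)) => //=.
  by change (mlt m0 (ex2 m0)); rewrite ex2_0 one_succ; apply: mlt0S.
move=> k; change (mlt k (ex2 k) -> mlt (k + 1)%mod (ex2 (k + 1)%mod)).
rewrite ex2_S => h; have := iota_step h; have := iota_ge0 k.
by rewrite iota_lt !iotaD iota1; lra.
Qed.

Definition p2 (n : N) : F := (iota (ex2 n))^-1.
Lemma iota_ex2_gt0 n : 0 < iota (ex2 n).
Proof. by have := proj1 (iota_lt _ _) (ex2_gt n); have := iota_ge0 n; lra. Qed.

Lemma p2_gt0 n : 0 < p2 n.
Proof. by rewrite invr_gt0 iota_ex2_gt0. Qed.

Lemma p2_S n : p2 (n + 1)%mod = p2 n / 2.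
Proof.
have h := iota_ex2_gt0 n; rewrite /p2 ex2_S iotaD.
by field; rewrite gt_eqF //=; lra.
Qed.

Definition nle (m n : N) : Prop := exists i, n = (m + i)%mod.
Lemma nle_trans m n k : nle m n -> nle n k -> nle m k.
Proof. by move=> [i ->] [j ->]; exists (i + j)%mod; rewrite maddA. Qed.

Lemma nle_addr m n : nle m (m + n)%mod.
Proof. by exists n. Qed.

Lemma nle_addl m n : nle m (n + m)%mod.
Proof. by exists n; rewrite maddC. Qed.

Lemma ex2_mono n i : mlt (ex2 n) (ex2 (n + i)%mod + 1)%mod.
Proof.
apply: (qf_induction (A:=(exp2 @ v1 < exp2 @ (v1 + v0) + One)%fm) (e:=E0 ;; n)) => //=.
  by rewrite maddn0; apply: mltS.
move=> k; rewrite maddnS.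
change (mlt (ex2 n) (ex2 (n + k)%mod + 1)%mod ->
        mlt (ex2 n) (ex2 (n + k + 1)%mod + 1)%mod).
rewrite ex2_S !iota_lt !iotaD iota1.
have /iota_lt := ex2_gt (n + k)%mod; have := iota_ge0 (n + k)%mod; lra.
Qed.

Lemma p2_le m n : nle m n -> p2 n <= p2 m.
Proof.
move=> [i ->]; rewrite lef_pV2 ?posrE ?iota_ex2_gt0 //.
have := ex2_mono m i; rewrite mltnS => -[/iota_lt/ltW //|->]; exact: lexx.
Qed.

(** A positive fraction with denominator [d + 1] has numerator at least 1, and [d + 1 <= 2^d];
    taking the index [d + 1] makes the inequality strict. *)
Lemma p2_small (e : F) : 0 < e -> exists n, p2 n < e.
Proof.
case: (fracE e) => a [b [d ->]] he; exists (d + 1)%mod.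
have hd := iota_ge0 d; have hd1 : 0 < iota d + 1 by lra.
have hab : 1 <= iota a - iota b.
  suff : iota b + 1 <= iota a by lra.
  by apply/iota_step/iota_lt; move: he; rewrite pmulr_lgt0 ?invr_gt0 //; lra.
have h1 : iota d + 1 <= iota (ex2 d) by apply/iota_step/ex2_gt.
have h2 : p2 d <= (iota d + 1)^-1 by rewrite lef_pV2 ?posrE ?iota_ex2_gt0.
have h3 : (iota d + 1)^-1 <= (iota a - iota b) / (iota d + 1).
  by rewrite ler_peMl // invr_ge0 ltW.
by rewrite p2_S; have := p2_gt0 d; lra.
Qed.

(** * Codes of rationals and their values *)

Definition code (a b d : N) : N :=
  eval (E0 ;; a ;; b ;; d) (rat_code v2 v1 v0).
Definition npair (i j : N) : N := eval (E0 ;; i ;; j) (Defs.pair v1 v0).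
Lemma npairE i j : npair i j = ((i + j) * (i + j) + i)%mod.
Proof. by []. Qed.

Lemma codeE a b d : code a b d = npair (npair a b) d.
Proof. by []. Qed.

Lemma npair_inj i j i' j' : npair i j = npair i' j' -> i = i' /\ j = j'.
Proof.
(* With s the sum of the components, the code lies between s^2 and s^2 + s < (s + 1)^2, so a larger
   sum gives a larger code. *)
have key a b a' b' : mlt (a + b)%mod (a' + b')%mod -> npair a b <> npair a' b'.
  move=> /iota_step h /(f_equal iota); rewrite !npairE.
  move: h; rewrite !(iotaD, iotaM).
  have := iota_ge0 a; have := iota_ge0 b; have := iota_ge0 a'; have := iota_ge0 b'.
  move=> ha' hb' ha hb hs e.
  have : (iota a + iota b + 1) * (iota a + iota b + 1) <=
         (iota a' + iota b') * (iota a' + iota b') by apply: ler_pM; lra.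
  by lra.
move=> h; case: (mlt_total (i + j)%mod (i' + j')%mod) => [/key//|[e|/key/nesym//]].
move: h; rewrite !npairE e; rewrite maddC [RHS]maddC => /maddI ei; split=> //.
by move: e; rewrite ei maddC [RHS]maddC => /maddI.
Qed.

Definition ratval (a b d : N) : F := (iota a - iota b) / (iota d + 1).
Definition valuates (c : N) (q : F) : Prop :=
  exists a b d, c = code a b d /\ q = ratval a b d.
Lemma valuates_fun c q q' : valuates c q -> valuates c q' -> q = q'.
Proof.
move=> [a [b [d [-> ->]]]] [a' [b' [d' [e ->]]]].
by move: e; rewrite !codeE => /npair_inj[/npair_inj[-> ->] ->].
Qed.

Lemma valuates_ex q : exists c, valuates c q.
Proof. by case: (fracE q) => a [b [d e]]; exists (code a b d), a, b, d. Qed.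

(** On numbers that code no rational the value is arbitrary, which is why [valid] accompanies it. *)
Definition val (c : N) : F := epsilon (inhabits 0) (valuates c).
Definition valid (c : N) : Prop := exists q, valuates c q.
Lemma val_eq c q : valuates c q -> val c = q.
Proof.
move=> h; apply: (valuates_fun (c:=c)) => //.
by apply: epsilon_spec; exists q.
Qed.

Lemma valid_code a b d : valid (code a b d).
Proof. by exists (ratval a b d), a, b, d. Qed.

Lemma val_code a b d : val (code a b d) = ratval a b d.
Proof. by apply: val_eq; exists a, b, d. Qed.

Lemma val_surj q : exists c, valid c /\ val c = q.
Proof. by have [c h] := valuates_ex q; exists c; split; [exists q|apply: val_eq]. Qed.

Lemma iota_numeral G (e : env M G) i : iota (eval e (numeral i)) = i%:R.
Proof.
elim: i => [|i ih]; first exact: iota0.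
by rewrite [numeral _]/= /= iotaD ih iota1 -natr1.
Qed.

Lemma frac_ltP (a b c d P Q : F) : 0 < P -> 0 < Q ->
  (a * Q + d * P < c * P + b * Q) = ((a - b) / P < (c - d) / Q).
Proof.
move=> hP hQ; rewrite ltr_pdivrMr // mulrAC ltr_pdivlMr // !mulrBl.
by apply/idP/idP; lra.
Qed.

Lemma frac_leP (a b c d P Q : F) : 0 < P -> 0 < Q ->
  (a * Q + d * P <= c * P + b * Q) = ((a - b) / P <= (c - d) / Q).
Proof.
move=> hP hQ; rewrite ler_pdivrMr // mulrAC ler_pdivlMr // !mulrBl.
by apply/idP/idP; lra.
Qed.

Lemma sat_nat_le G (e : env M G) s t : sat (nat_le s t) e <-> iota (eval e s) <= iota (eval e t).
Proof.
rewrite sat_or /= iota_lt le_eqVlt orbC; split.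
  by move=> [->//|->]; rewrite eqxx orbT.
by move=> /orP[h|/eqP/iota_inj h]; [left|right].
Qed.

(** Treats [<] and [<=] together: all that matters is that [r] interprets [rel] and is invariant
    under clearing positive denominators. *)
Lemma sat_rat_cmp (rel : forall G, tm G Nat -> tm G Nat -> fm G) (r : F -> F -> Prop) :
  (forall G (e : env M G) s t, sat (rel G s t) e <-> r (iota (eval e s)) (iota (eval e t))) ->
  (forall a b c d P Q : F, 0 < P -> 0 < Q ->
     (r (a * Q + d * P) (c * P + b * Q) <-> r ((a - b) / P) ((c - d) / Q))) ->
  forall G (e : env M G) u i m v j n,
  sat (rat_cmp rel u i m v j n) e <->
  valid (eval e u) /\ valid (eval e v) /\
  r (val (eval e u) + i%:R * p2 (eval e m)) (val (eval e v) + j%:R * p2 (eval e n)).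
Proof.
move=> hrel hr G e u i m v j n.
have key a b d k x : (iota a * iota (ex2 x) + k%:R * (iota d + 1) -
     (iota b * iota (ex2 x) + 0 * (iota d + 1))) / ((iota d + 1) * iota (ex2 x)) =
     ratval a b d + k%:R * p2 x :> F.
  have h1 := iota_ex2_gt0 x; have h2 : 0 < iota d + 1 by have := iota_ge0 d; lra.
  by rewrite /ratval /p2; field; rewrite !gt_eqF.
have pos d x : 0 < (iota d + 1) * iota (ex2 x) :> F.
  by apply: mulr_gt0; [have := iota_ge0 d; lra|apply: iota_ex2_gt0].
have core a b d a' b' d' : eval e u = code a b d -> eval e v = code a' b' d' ->
  (sat (frac_cmp rel
       (frac_add (Frac v5 v4 (v3 + One)) (dyadic i (lift [Nat; Nat; Nat; Nat; Nat; Nat] m)))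
       (frac_add (Frac v2 v1 (v0 + One)) (dyadic j (lift [Nat; Nat; Nat; Nat; Nat; Nat] n))))
    (e ;; a ;; b ;; d ;; a' ;; b' ;; d') <->
   r (val (eval e u) + i%:R * p2 (eval e m)) (val (eval e v) + j%:R * p2 (eval e n))).
  move=> -> ->; rewrite !val_code -!key -hr ?pos // hrel /=.
  rewrite /lift !eval_ren /= !iotaD !iotaM !iotaD !iotaM !iota_numeral !iotaD iota0 !iota1.
  by [].
rewrite /rat_cmp sat_ex; split.
  move=> [a]; rewrite sat_ex => -[b]; rewrite sat_ex => -[d].
  rewrite sat_ex => -[a']; rewrite sat_ex => -[b']; rewrite sat_ex => -[d'].
  rewrite !sat_and => -[hu [hv h]].
  have eu : eval e u = code a b d by rewrite -[RHS]hu /lift eval_ren.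
  have ev : eval e v = code a' b' d' by rewrite -[RHS]hv /lift eval_ren.
  split; first by rewrite eu; apply: valid_code.
  split; first by rewrite ev; apply: valid_code.
  exact/core/h.
move=> [[q [a [b [d [eu eq]]]]] [[q' [a' [b' [d' [ev eq']]]]] h]].
exists a; rewrite sat_ex; exists b; rewrite sat_ex; exists d.
rewrite sat_ex; exists a'; rewrite sat_ex; exists b'; rewrite sat_ex; exists d'.
rewrite !sat_and; split; first by rewrite /= /lift eval_ren; exact: eu.
split; first by rewrite /= /lift eval_ren; exact: ev.
exact/core.
Qed.

Lemma sat_rat_lt G (e : env M G) u i m v j n :
  sat (rat_lt u i m v j n) e <->
  valid (eval e u) /\ valid (eval e v) /\
  val (eval e u) + i%:R * p2 (eval e m) < val (eval e v) + j%:R * p2 (eval e n).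
Proof.
apply: (sat_rat_cmp (r:=fun x y : F => x < y)).
  by move=> *; apply: iota_lt.
by move=> *; rewrite frac_ltP.
Qed.

Lemma sat_rat_le G (e : env M G) u i m v j n :
  sat (rat_le u i m v j n) e <->
  valid (eval e u) /\ valid (eval e v) /\
  val (eval e u) + i%:R * p2 (eval e m) <= val (eval e v) + j%:R * p2 (eval e n).
Proof.
apply: (sat_rat_cmp (r:=fun x y : F => x <= y)).
  by move=> *; apply: sat_nat_le.
by move=> *; rewrite frac_leP.
Qed.

(** * Meaning of the formulas on reals, limits and jumps *)

Definition approx (x : dom M ty1) (n : N) : F := val (app x n).
Definition vld (x : dom M ty1) (n : N) : Prop := valid (app x n).

Definition isreal (x : dom M ty1) : Prop := forall n i,
  vld x n /\ vld x (n + i)%mod /\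
  approx x n < approx x (n + i)%mod + p2 n /\ approx x (n + i)%mod < approx x n + p2 n.
Definition req (x y : dom M ty1) : Prop := forall n, vld x n /\ vld y n /\
  approx x n <= approx y n + 2 * p2 n /\ approx y n <= approx x n + 2 * p2 n.
Definition rlt (x y : dom M ty1) : Prop := exists n, vld x n /\ vld y n /\
  approx x n + 2 * p2 n < approx y n.
Definition rclose (x y : dom M ty1) (k : N) : Prop := exists n, vld x n /\ vld y n /\
  approx x n + 2 * p2 n < approx y n + p2 k /\ approx y n + 2 * p2 n < approx x n + p2 k.

Definition rconst (c : N) : dom M ty1 := app mpi c.
Lemma rconst_app c n : app (rconst c) n = c.
Proof. exact: pi_app. Qed.

Definition r0 := rconst (code m0 m0 m0).
Definition r1 := rconst (code m1 m0 m0).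
Definition inunit x := isreal x /\ ~ rlt x r0 /\ ~ rlt r1 x.

Lemma sat_is_real G (e : env M G) x : sat (is_real x) e <-> isreal (eval e x).
Proof.
rewrite /is_real sat_all; split=> h n; have := h n; rewrite ?sat_all => {}h i; have := h i;
  rewrite sat_and !sat_rat_lt /= /lift !eval_ren /= !mul0r !addr0 !mul1r /approx /vld; tauto.
Qed.

Lemma sat_real_eq G (e : env M G) x y : sat (real_eq x y) e <-> req (eval e x) (eval e y).
Proof.
rewrite /real_eq sat_all; split=> h n; have := h n;
  rewrite sat_and !sat_rat_le /= /lift !eval_ren /= !mul0r !addr0 /approx /vld; tauto.
Qed.

Lemma sat_real_lt G (e : env M G) x y : sat (real_lt x y) e <-> rlt (eval e x) (eval e y).
Proof.
rewrite /real_lt sat_ex; split=> -[n h]; exists n; move: h;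
  by rewrite sat_rat_lt /= /lift !eval_ren /= !mul0r !addr0.
Qed.

Lemma sat_real_close G (e : env M G) x y k :
  sat (real_close x y k) e <-> rclose (eval e x) (eval e y) (eval e k).
Proof.
rewrite /real_close sat_ex; split=> -[n h]; exists n; move: h;
  rewrite sat_and !sat_rat_lt /= /lift !eval_ren /= !mul1r /approx /vld; tauto.
Qed.

Lemma sat_in_unit G (e : env M G) x : sat (in_unit x) e <-> inunit (eval e x).
Proof.
have h0 : sat (real_lt x Defs.real0) e <-> rlt (eval e x) r0 by rewrite sat_real_lt.
have h1 : sat (real_lt Defs.real1 x) e <-> rlt r1 (eval e x) by rewrite sat_real_lt.
by rewrite /in_unit !sat_and sat_is_real (sat_not (real_lt x _)) (sat_not (real_lt _ x)) h0 h1.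
Qed.

Definition leftlim (f : dom M (ty1 ~> ty1)) (x l : dom M ty1) : Prop :=
  forall k, exists N, forall y, inunit y -> rlt y x -> rclose x y N ->
    rclose (app f y) l k.
Definition rightlim (f : dom M (ty1 ~> ty1)) (x l : dom M ty1) : Prop :=
  forall k, exists N, forall y, inunit y -> rlt x y -> rclose x y N ->
    rclose (app f y) l k.

Lemma sat_left_limit G (e : env M G) f x l :
  sat (left_limit f x l) e <-> leftlim (eval e f) (eval e x) (eval e l).
Proof.
pose D := [ty1; Nat; Nat].
have E k n y : sat (in_unit v0 --> real_lt v0 (lift D x) --> real_close (lift D x) v0 v1 -->
     real_close (lift D f @ v0) (lift D l) v2)%fm (e ;; k ;; n ;; y) <->
   (inunit y -> rlt y (eval e x) -> rclose (eval e x) y n ->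
    rclose (app (eval e f) y) (eval e l) k).
  have e1 : sat (in_unit v0) (e ;; k ;; n ;; y) <-> inunit y by rewrite sat_in_unit.
  have e2 : sat (real_lt v0 (lift D x)) (e ;; k ;; n ;; y) <-> rlt y (eval e x).
    by rewrite sat_real_lt /lift eval_ren.
  have e3 : sat (real_close (lift D x) v0 v1) (e ;; k ;; n ;; y) <-> rclose (eval e x) y n.
    by rewrite sat_real_close /lift eval_ren.
  have e4 : sat (real_close (lift D f @ v0) (lift D l) v2) (e ;; k ;; n ;; y) <->
      rclose (app (eval e f) y) (eval e l) k.
    by rewrite sat_real_close /= /lift !eval_ren.
  split=> h a b c.
    exact: (proj1 e4 (h (proj2 e1 a) (proj2 e2 b) (proj2 e3 c))).
  exact: (proj2 e4 (h (proj1 e1 a) (proj1 e2 b) (proj1 e3 c))).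
rewrite /left_limit sat_all; split=> h k.
  have /sat_ex[n hn] := h k; exists n => y; exact/E/hn.
have [n hn] := h k; rewrite sat_ex; exists n; rewrite sat_all => y; exact/E/hn.
Qed.

Lemma sat_right_limit G (e : env M G) f x l :
  sat (right_limit f x l) e <-> rightlim (eval e f) (eval e x) (eval e l).
Proof.
pose D := [ty1; Nat; Nat].
have E k n y : sat (in_unit v0 --> real_lt (lift D x) v0 --> real_close (lift D x) v0 v1 -->
     real_close (lift D f @ v0) (lift D l) v2)%fm (e ;; k ;; n ;; y) <->
   (inunit y -> rlt (eval e x) y -> rclose (eval e x) y n ->
    rclose (app (eval e f) y) (eval e l) k).
  have e1 : sat (in_unit v0) (e ;; k ;; n ;; y) <-> inunit y by rewrite sat_in_unit.
  have e2 : sat (real_lt (lift D x) v0) (e ;; k ;; n ;; y) <-> rlt (eval e x) y.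
    by rewrite sat_real_lt /lift eval_ren.
  have e3 : sat (real_close (lift D x) v0 v1) (e ;; k ;; n ;; y) <-> rclose (eval e x) y n.
    by rewrite sat_real_close /lift eval_ren.
  have e4 : sat (real_close (lift D f @ v0) (lift D l) v2) (e ;; k ;; n ;; y) <->
      rclose (app (eval e f) y) (eval e l) k.
    by rewrite sat_real_close /= /lift !eval_ren.
  split=> h a b c.
    exact: (proj1 e4 (h (proj2 e1 a) (proj2 e2 b) (proj2 e3 c))).
  exact: (proj2 e4 (h (proj1 e1 a) (proj1 e2 b) (proj1 e3 c))).
rewrite /right_limit sat_all; split=> h k.
  have /sat_ex[n hn] := h k; exists n => y; exact/E/hn.
have [n hn] := h k; rewrite sat_ex; exists n; rewrite sat_all => y; exact/E/hn.
Qed.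

Definition jump (f : dom M (ty1 ~> ty1)) (x : dom M ty1) : Prop :=
  rlt r0 x /\ rlt x r1 /\ exists l u,
    isreal l /\ leftlim f x l /\ isreal u /\ rightlim f x u /\ ~ req l u.

Lemma sat_jump G (e : env M G) f x :
  sat (jump_discontinuity f x) e <-> jump (eval e f) (eval e x).
Proof.
have E l u : sat (is_real v1 /\ left_limit (lift [ty1; ty1] f) (lift [ty1; ty1] x) v1 /\
     is_real v0 /\ right_limit (lift [ty1; ty1] f) (lift [ty1; ty1] x) v0 /\
     ~ real_eq v1 v0)%fm (e ;; l ;; u) <->
   isreal l /\ leftlim (eval e f) (eval e x) l /\ isreal u /\
   rightlim (eval e f) (eval e x) u /\ ~ req l u.
  rewrite !sat_and !sat_is_real sat_left_limit sat_right_limit (sat_not (real_eq _ _)) sat_real_eq.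
  by rewrite /lift !eval_ren.
rewrite /jump_discontinuity !sat_and !sat_real_lt /jump.
have -> : eval e Defs.real0 = r0 by [].
have -> : eval e Defs.real1 = r1 by [].
split=> -[h0 [h1 h]]; split=> //; split=> //.
  by move: h; rewrite sat_ex => -[l]; rewrite sat_ex => -[u /E]; exists l, u.
move: h => [l [u h]]; rewrite sat_ex; exists l; rewrite sat_ex; exists u.
exact/E.
Qed.

(** * Estimates between approximations *)

Lemma real_vld x n : isreal x -> vld x n.
Proof. by move=> h; have [] := h n m0. Qed.

Lemma real_cauchy x m n : isreal x -> nle m n ->
  approx x m < approx x n + p2 m /\ approx x n < approx x m + p2 m.
Proof. by move=> h [i ->]; have [_ [_]] := h m i. Qed.

Lemma real_cross x m n : isreal x -> approx x m < approx x n + p2 m + p2 n.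
Proof.
move=> h; have [h1 _] := real_cauchy h (nle_addr m n).
by have [_ h2] := real_cauchy h (nle_addl n m); lra.
Qed.

(** The slack [2 * p2 n] in [rclose] absorbs the later drift of both sequences, so what is left over
    at [n] is a margin that persists at all later indices. *)
Lemma rclose_ev x y k : isreal x -> isreal y -> rclose x y k ->
  exists n d, 0 < d /\ forall m, nle n m ->
    approx x m + d <= approx y m + p2 k /\ approx y m + d <= approx x m + p2 k.
Proof.
move=> hx hy [n [_ [_ [h1 h2]]]]; exists n.
pose d1 := approx y n + p2 k - approx x n - 2 * p2 n; pose d2 := approx x n + p2 k - approx y n - 2 * p2 n.
have hd : exists d, 0 < d /\ d <= d1 /\ d <= d2.
  case: (lerP d1 d2) => h; [exists d1|exists d2]; rewrite /d1 /d2 in h *; split; lra.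
have [d [hd0 [hd1 hd2]]] := hd; exists d; split=> // m hm.
have [a1 a2] := real_cauchy hx hm; have [b1 b2] := real_cauchy hy hm.
rewrite /d1 /d2 in hd1 hd2; lra.
Qed.

Lemma ev_rclose x y k n d : isreal x -> isreal y -> 0 < d ->
  (forall m, nle n m -> approx x m + d <= approx y m + p2 k /\ approx y m + d <= approx x m + p2 k) ->
  rclose x y k.
Proof.
move=> hx hy hd h; have [i hi] := p2_small (divr_gt0 hd (ltr0Sn _ 1)).
exists (n + i)%mod; split; first exact: real_vld.
split; first exact: real_vld.
have [h1 h2] := h _ (nle_addr n i); have := p2_le (nle_addl i n).
split; lra.
Qed.

Lemma rclose_trans x y z k : isreal x -> isreal y -> isreal z ->
  rclose x y (k + 1)%mod -> rclose z y (k + 1)%mod -> rclose x z k.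
Proof.
move=> hx hy hz /rclose_ev[] // n [d [hd h]] /rclose_ev[] // n' [d' [hd' h']].
apply: (ev_rclose (n:=(n + n')%mod) (d:=d)) => // m hm.
have [a1 a2] := h m (nle_trans (nle_addr n n') hm).
have [b1 b2] := h' m (nle_trans (nle_addl n' n) hm).
by move: a1 a2 b1 b2; rewrite !p2_S; split; lra.
Qed.

(** If [req] fails at [n], the approximations there differ by more than [2 * p2 n]. Each drifts by
    less than [p2 n] afterwards, so the excess survives, and [p2 k] is taken below half of it. *)
Lemma not_req_gap x y : isreal x -> isreal y -> ~ req x y ->
  exists k n, forall m, nle n m -> 2 * p2 k <= approx x m - approx y m \/ 2 * p2 k <= approx y m - approx x m.
Proof.
move=> hx hy h.
have [n hn] : exists n, ~ (approx x n <= approx y n + 2 * p2 n /\ approx y n <= approx x n + 2 * p2 n).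
  apply: NNPP => hn; apply: h => n; do 2 (split; first exact: real_vld).
  by apply: NNPP => h'; apply: hn; exists n.
have [h1|h1] := lerP (approx x n) (approx y n + 2 * p2 n); last first.
  have hd : 0 < (approx x n - approx y n - 2 * p2 n) / 2 by apply: divr_gt0; lra.
  have [k hk] := p2_small hd; exists k, n => m hm; left.
  by have [] := real_cauchy hx hm; have [] := real_cauchy hy hm; lra.
have [h2|h2] := lerP (approx y n) (approx x n + 2 * p2 n); first by case: hn.
have hd : 0 < (approx y n - approx x n - 2 * p2 n) / 2 by apply: divr_gt0; lra.
have [k hk] := p2_small hd; exists k, n => m hm; right.
by have [] := real_cauchy hx hm; have [] := real_cauchy hy hm; lra.
Qed.

(** At a common late index the triangle inequality bounds the gap strictly by [p2 k] plus twice
    [p2 (k + 1)], which is [2 * p2 k]. *)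
Lemma no_gap x y a b k : isreal x -> isreal y -> isreal a -> isreal b ->
  rclose a x (k + 1)%mod -> rclose b y (k + 1)%mod -> rclose a b k ->
  (exists n, forall m, nle n m ->
    2 * p2 k <= approx x m - approx y m \/ 2 * p2 k <= approx y m - approx x m) ->
  False.
Proof.
move=> hx hy ha hb /rclose_ev[] // n1 [d1 [hd1 h1]] /rclose_ev[] // n2 [d2 [hd2 h2]].
move=> /rclose_ev[] // n3 [d3 [hd3 h3]] [n4 h4].
pose m := (n1 + (n2 + (n3 + n4)))%mod.
have l1 : nle n1 m by apply: nle_addr.
have l2 : nle n2 m by apply: nle_trans (nle_addl _ _); apply: nle_addr.
have l3 : nle n3 m by do 2 apply: nle_trans (nle_addl _ _); apply: nle_addr.
have l4 : nle n4 m by do 2 apply: nle_trans (nle_addl _ _); apply: nle_addl.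
have := h1 m l1; have := h2 m l2; have := h3 m l3; have := h4 m l4; rewrite !p2_S.
move=> h [a1 a2] [b1 b2] [c1 c2]; case: h => h; lra.
Qed.

Lemma val0 : val (code m0 m0 m0) = 0.
Proof. by rewrite val_code /ratval iota0 subrr mul0r. Qed.

Lemma val1 : val (code m1 m0 m0) = 1.
Proof. by rewrite val_code /ratval iota0 iota1 subr0 add0r divr1. Qed.

Lemma X_rconst c n : approx (rconst c) n = val c.
Proof. by rewrite /approx rconst_app. Qed.

Lemma vld_rconst c n : vld (rconst c) n = valid c.
Proof. by rewrite /vld rconst_app. Qed.

Lemma inunit_rconst c : valid c -> 0 <= val c -> val c <= 1 -> inunit (rconst c).
Proof.
move=> hc h0 h1; split; [|split].
- by move=> n i; rewrite !vld_rconst !X_rconst; have := p2_gt0 n; do !split=> //; lra.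
- by move=> [n [_ [_]]]; rewrite !X_rconst val0; have := p2_gt0 n; lra.
- by move=> [n [_ [_]]]; rewrite !X_rconst val1; have := p2_gt0 n; lra.
Qed.

(** Three extra halvings yield the factor 8, room for the few multiples of [p2 m] that are spent
    around [x] in [jump_index]. *)
Lemma big4 a b c d : exists m, nle a m /\ nle b m /\ nle c m /\ nle d m /\
  8 * p2 m <= p2 a /\ 8 * p2 m <= p2 b /\ 8 * p2 m <= p2 c /\ 8 * p2 m <= p2 d.
Proof.
pose s := (a + (b + (c + d)))%mod; pose m := (s + m1 + m1 + m1)%mod.
have hs : nle s m by exists (m1 + m1 + m1)%mod; rewrite !maddA.
have e : 8 * p2 m = p2 s by rewrite /m !p2_S; field.
have l1 : nle a s by apply: nle_addr.
have l2 : nle b s by apply: nle_trans (nle_addl _ _); apply: nle_addr.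
have l3 : nle c s by do 2 apply: nle_trans (nle_addl _ _); apply: nle_addr.
have l4 : nle d s by do 2 apply: nle_trans (nle_addl _ _); apply: nle_addl.
exists m; rewrite e; do ?split; try exact: nle_trans hs; exact: p2_le.
Qed.

(** This and [above] are [rlt] against a constant sequence, restated for field elements so that no
    code has to be chosen. *)
Definition below (q : F) x : Prop := exists n, q + 2 * p2 n < approx x n.
Definition above (q : F) x : Prop := exists n, approx x n + 2 * p2 n < q.

Lemma below_ev q x n : isreal x -> below q x -> q < approx x n + p2 n.
Proof. by move=> hx [m hm]; have := real_cross m n hx; have := p2_gt0 m; lra. Qed.

Lemma not_below q x n : isreal x -> ~ below q x -> approx x n <= q + p2 n.
Proof.
move=> hx h; apply: contra_notT h; rewrite -ltNge => h.
have [k hk] : exists k, p2 k < (approx x n - q - p2 n) / 2 by apply/p2_small/divr_gt0; lra.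
exists (n + k)%mod; have := real_cauchy hx (nle_addr n k).
by have := p2_le (nle_addl k n); lra.
Qed.

(** * The sequence of jumps *)

(* [osc f n q] is vacuous when [n] does not code a pair. *)
Definition osc (f : dom M (ty1 ~> ty1)) (n : N) (q : F) : Prop :=
  forall p k a b, n = npair p k -> inunit (rconst a) -> inunit (rconst b) ->
    valid p -> valid a -> val p < val a -> val a < q ->
    valid b -> val p < val b -> val b < q ->
    rclose (app f (rconst a)) (app f (rconst b)) k.

Lemma osc_down f n q q' : q' <= q -> osc f n q -> osc f n q'.
Proof.
move=> hq h p k a b e ha hb vp va h1 h2 vb h3 h4.
by apply: (h p) => //; lra.
Qed.

Lemma jump_index f x : (forall y, inunit y -> isreal (app f y)) ->
  isreal x -> jump f x -> exists n,
  (forall q, below q x -> osc f n q) /\ (forall q, above q x -> ~ osc f n q).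
Proof.
move=> hf hx [[n0 [_ [_ h0]]] [[n1 [_ [_ h1]]] [l [u [hl [Ll [hu [Lu hne]]]]]]]].
move: h0 h1; rewrite !X_rconst val0 val1 => h0 h1.
have [k gap] := not_req_gap hl hu hne.
have [N0 hN0] := Ll (k + 1)%mod; have [N1 hN1] := Lu (k + 1)%mod.
have [m0 [l1 [l2 [_ [_ [s1 [s2 [s3 _]]]]]]]] := big4 n0 n1 N0 N0.
(* A rational between [p] and [x] is within [4 * p2 m0] of the approximation of [x] at [m0]. With
   the slack [2 * p2 m0] of [rclose] this stays below [8 * p2 m0 <= p2 N0], so the left limit
   applies. *)
have [p [vp ep]] := val_surj (approx x m0 - 4 * p2 m0).
have := p2_gt0 m0; have := real_cauchy hx l1; have := real_cauchy hx l2.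
move=> [c1 c2] [c3 c4] pm0.
have near a : inunit (rconst a) -> valid a -> val p < val a -> below (val a) x ->
    rclose (app f (rconst a)) l (k + 1)%mod.
  move=> ia va hpa hax; have := below_ev m0 hx hax => hax'; apply: hN0 => //.
    by move: hax => [n hn]; exists n; rewrite vld_rconst X_rconst; split=> //; split=> //; apply: real_vld.
  exists m0; rewrite vld_rconst X_rconst; split; first exact: real_vld.
  by split=> //; split; lra.
exists (npair p k); split.
  move=> q hq p' k' a b /npair_inj[<- <-] ia ib _ va h2 h3 vb h4 h5.
  have bq c : val c < q -> below (val c) x.
    by move=> hc; move: hq => [n hn]; exists n; lra.
  apply: (rclose_trans (y:=l)); try exact: hf; try exact: hl.
    by apply: near => //; apply: bq.
  by apply: near => //; apply: bq.
move=> q [n2 h2] hosc.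
have [m1 [k1 [k2 [k3 [k4 [t1 [t2 [t3 t4]]]]]]]] := big4 n2 n1 N1 n0.
have := p2_gt0 m1; have := real_cauchy hx k1; have := real_cauchy hx k2.
have := real_cauchy hx k4; have := real_cross m0 m1 hx.
move=> d0 [d1 d2] [d3 d4] [d5 d6] pm1.
(* The offset 3 exceeds the slack 2 in [below] and [rlt], so [a < x < b], and it is less than the
   offset 4 of [p], so [p < a]. The index [m1] is late enough for [b] to stay below [q] and 1 and
   within [p2 N1] of [x]. *)
have [a [va ea]] := val_surj (approx x m0 - 3 * p2 m0).
have [b [vb eb]] := val_surj (approx x m1 + 3 * p2 m1).
have q1 := p2_gt0 n1; have q2 := p2_gt0 n2.
have ia : inunit (rconst a) by apply: inunit_rconst => //; lra.
have ib : inunit (rconst b) by apply: inunit_rconst => //; lra.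
have ca : rclose (app f (rconst a)) l (k + 1)%mod.
  by apply: near => //; [lra|exists m0; lra].
have cb : rclose (app f (rconst b)) u (k + 1)%mod.
  apply: hN1 => //.
    exists m1; rewrite vld_rconst X_rconst; split; first exact: real_vld.
    by split=> //; lra.
  exists m1; rewrite vld_rconst X_rconst; split; first exact: real_vld.
  by split=> //; split; lra.
apply: (no_gap hl hu (hf _ ia) (hf _ ib) ca cb _ gap).
by apply: (hosc p) => //; lra.
Qed.

(* [s] is the supremum of the [q] in the unit interval with [osc f n q]: its [m]-th entry
   is the last point of the grid of mesh [2^-(m+1)] at which [osc f n] holds, or 0. *)
Definition approximates f (n : N) (s : dom M ty1) : Prop := forall m,
  vld s m /\ 0 <= approx s m /\ approx s m <= 1 /\
  (approx s m = 0 \/ osc f n (approx s m)) /\ (approx s m = 1 \/ ~ osc f n (approx s m + p2 (m + 1)%mod)).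

(** [osc] fails one mesh beyond entry [m] and is closed downwards, so no entry at which it holds
    lies further up. The exceptional entries 0 and 1 fit because all entries lie in the unit
    interval. *)
Lemma approximates_le f n s m k : approximates f n s -> approx s k <= approx s m + p2 (m + 1)%mod.
Proof.
move=> h; have [_ [a0 [_ [_ a]]]] := h m; have [_ [_ [b1 [b _]]]] := h k.
have hp := p2_gt0 (m + 1)%mod.
case: a => [->|a]; first by lra.
rewrite leNgt; apply/negP => h'; apply: a.
by case: b => [e|/osc_down]; [lra|apply; apply: ltW].
Qed.

Lemma approximates_real f n s : approximates f n s -> isreal s.
Proof.
move=> h m i; have [v1 _] := h m; have [v2 _] := h (m + i)%mod; do 2 split=> //.
have h1 := approximates_le m (m + i)%mod h; have h2 := approximates_le (m + i)%mod m h.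
have h3 := p2_le (nle_addr m i); have h4 := p2_gt0 m.
by move: h1 h2; rewrite !p2_S; split; lra.
Qed.

Lemma approximates_jump f x n s : isreal x -> rlt r0 x -> rlt x r1 ->
  (forall q, below q x -> osc f n q) -> (forall q, above q x -> ~ osc f n q) ->
  approximates f n s -> req s x.
Proof.
move=> hx [n0 [_ [_ h0]]] [n1 [_ [_ h1]]] hb ha hs m.
move: h0 h1; rewrite !X_rconst val0 val1 => h0 h1.
have [vs [s0 [s1 [sl su]]]] := hs m.
have pm := p2_gt0 m; have hpS := p2_S m.
split=> //; split; first exact: real_vld.
split.
  (* The entry 0 may be the default, at which [osc] need not hold; then the bound follows from
     [0 < x]. Symmetrically, the entry 1 is covered by [x < 1] below. *)
  case: sl => [->|h].
    have : below 0 x by exists n0.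
    by move=> /(below_ev m hx); lra.
  by rewrite leNgt; apply/negP => h'; apply: (ha (approx s m)) h; exists m.
case: su => [->|h]; first by have := real_cross m n1 hx; have := p2_gt0 n1; lra.
have : ~ below (approx s m + p2 (m + 1)%mod) x by move=> /hb.
by move=> /(not_below m hx); lra.
Qed.

(* The largest [i <= j] with [c i = 0], or 0 if there is none. *)
Definition bmax {G} : tm G (ty1 ~> Nat ~> Nat) :=
  lam (CRec @ lam (lam (isz (v2 @ (v1 + One)%tm) * (v1 + One) +
                        isz (isz (v2 @ (v1 + One)%tm)) * v0)%tm) @ Zero).
Definition bm (c : dom M ty1) (j : N) : N := app (app (eval E0 bmax) c) j.

Lemma bm0 c : bm c m0 = m0.
Proof. by rewrite /bm /bmax eval_lam /= rec0. Qed.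

Lemma bmS c j : bm c (j + 1)%mod =
  eval (E0 ;; c ;; j ;; bm c j) (isz (v2 @ (v1 + One)%tm) * (v1 + One) +
                        isz (isz (v2 @ (v1 + One)%tm)) * v0)%tm.
Proof.
pose t : tm [ty1] (Nat ~> Nat ~> Nat) :=
  lam (lam (isz (v2 @ (v1 + One)%tm) * (v1 + One) + isz (isz (v2 @ (v1 + One)%tm)) * v0)%tm).
have e k : bm c k = app (app (app mrec (eval (E0 ;; c) t)) m0) k.
  by rewrite /bm /bmax eval_lam.
by rewrite e recS -e /t !eval_lam.
Qed.

Lemma bmS_hit c j : app c (j + 1)%mod = m0 -> bm c (j + 1)%mod = (j + 1)%mod.
Proof.
move=> h; rewrite bmS; set e := (_ ;; bm c j).
have h1 : eval e (isz (v2 @ (v1 + One)%tm)) = m1 by apply: isz0.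
have h2 : eval e (isz (isz (v2 @ (v1 + One)%tm))) = m0.
  by apply: iszS; rewrite h1; apply: one_nz.
change (eval e (isz (v2 @ (v1 + One)%tm)) * (j + 1) +
        eval e (isz (isz (v2 @ (v1 + One)%tm))) * bm c j = j + 1)%mod.
by rewrite h1 h2 mmul1n mmul0n maddn0.
Qed.

Lemma bmS_miss c j : app c (j + 1)%mod <> m0 -> bm c (j + 1)%mod = bm c j.
Proof.
move=> h; rewrite bmS; set e := (_ ;; bm c j).
have h1 : eval e (isz (v2 @ (v1 + One)%tm)) = m0 by apply: iszS.
have h2 : eval e (isz (isz (v2 @ (v1 + One)%tm))) = m1 by apply: isz0.
change (eval e (isz (v2 @ (v1 + One)%tm)) * (j + 1) +
        eval e (isz (isz (v2 @ (v1 + One)%tm))) * bm c j = bm c j)%mod.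
by rewrite h1 h2 mmul1n mmul0n madd0n.
Qed.

(** The formula [A] is quantifier-free because [c] is a parameter, however complex the condition
    that [c] decides. Recording a failure at the next index is enough, since [osc] is closed
    downwards. *)
Lemma bmP c j : mlt (bm c j) (j + 1)%mod /\ (bm c j = m0 \/ app c (bm c j) = m0) /\
  (bm c j = j \/ app c (bm c j + 1)%mod <> m0).
Proof.
pose A : fm [Nat; ty1] := (bmax @ v1 @ v0 < v0 + One /\
  (bmax @ v1 @ v0 == Zero \/ v1 @ (bmax @ v1 @ v0) == Zero) /\
  (bmax @ v1 @ v0 == v0 \/ ~ v1 @ (bmax @ v1 @ v0 + One)%tm == Zero))%fm.
have AE k : sat A (E0 ;; c ;; k) <->
  (mlt (bm c k) (k + 1)%mod /\ (bm c k = m0 \/ app c (bm c k) = m0) /\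
  (bm c k = k \/ app c (bm c k + 1)%mod <> m0)).
  by rewrite /A !sat_and !sat_or.
rewrite -AE; apply: qf_induction => //.
  by rewrite AE bm0; split; [apply: mlt0S|split; left].
move=> k; rewrite !AE => -[h1 [h2 h3]].
have [h|h] := excluded_middle_informative (app c (k + 1)%mod = m0).
  by rewrite bmS_hit //; split; [apply: mltS|split; [right|left]].
rewrite bmS_miss //; split; first exact: mlt_trans h1 (mltS _).
by split=> //; right; case: h3 => // ->.
Qed.

(** * The sequence of suprema as a term *)

(** Codes j / 2^(m+1); a coded denominator [d] stands for [d + 1], hence the subtraction of one. *)
Definition grid G (j m : tm G Nat) : tm G Nat :=
  rat_code j Zero (nsub @ (exp2 @ (m + One)%tm) @ One).

(** The variables, from [v0] upwards, are b, a, k, p, j, m, n, E, f. The points a and b enter [f] as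
    constant sequences [CPi @ a] and [CPi @ b], so that only numbers are quantified and the
    condition is arithmetical in [f]. *)
Definition osc_body : fm [Nat; Nat; Nat; Nat; Nat; Nat; Nat; ty2; ty1 ~> ty1] :=
  let f := Var (VS (VS (VS (VS (VS (VS (VS (VS VZ)))))))) in
  let n := Var (VS (VS (VS (VS (VS (VS VZ)))))) in
  n == Defs.pair v3 v2 --> in_unit (CPi @ v1) --> in_unit (CPi @ v0) -->
  rat_lt v3 0 Zero v1 0 Zero --> rat_lt v1 0 Zero (grid v4 v5) 0 Zero -->
  rat_lt v3 0 Zero v0 0 Zero --> rat_lt v0 0 Zero (grid v4 v5) 0 Zero -->
  real_close (f @ (CPi @ v1)) (f @ (CPi @ v0)) v2.
Definition osc_fm : fm [Nat; Nat; Nat; ty2; ty1 ~> ty1] :=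
  All Nat (All Nat (All Nat (All Nat osc_body))).

Lemma arith_osc : arith osc_fm.
Proof. by rewrite /=; tauto. Qed.

Lemma eval_grid G (e : env M G) j m :
  valid (eval e (grid j m)) /\ val (eval e (grid j m)) = iota (eval e j) * p2 (eval e m + 1)%mod.
Proof.
have -> : eval e (grid j m) =
  code (eval e j) m0 (msub (ex2 (eval e m + 1)%mod) m1) by [].
split; first exact: valid_code.
rewrite val_code /ratval iota0 subr0 /p2 -iota1 -iotaD maddC.
rewrite msubnKC //.
have := ex2_gt (eval e m + 1)%mod; rewrite !iota_lt !iotaD iota1.
by have := iota_ge0 (eval e m); lra.
Qed.

Lemma sat_osc f E n m j :
  sat osc_fm (E0 ;; f ;; E ;; n ;; m ;; j) <-> osc f n (iota j * p2 (m + 1)%mod).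
Proof.
have core p k a b : sat osc_body (E0 ;; f ;; E ;; n ;; m ;; j ;; p ;; k ;; a ;; b) <->
   (n = npair p k -> inunit (rconst a) -> inunit (rconst b) ->
    valid p -> valid a -> val p < val a -> val a < iota j * p2 (m + 1)%mod ->
    valid b -> val p < val b -> val b < iota j * p2 (m + 1)%mod ->
    rclose (app f (rconst a)) (app f (rconst b)) k).
  set e := (_ ;; b).
  have [gv ge] : valid (eval e (grid v4 v5)) /\
    val (eval e (grid v4 v5)) = iota j * p2 (m + 1)%mod by apply: eval_grid.
  have i1 : sat (in_unit (CPi @ v1)) e <-> inunit (rconst a) by rewrite sat_in_unit.
  have i2 : sat (in_unit (CPi @ v0)) e <-> inunit (rconst b) by rewrite sat_in_unit.
  have c1 u v : sat (rat_lt u 0 Zero v 0 Zero) e <->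
      valid (eval e u) /\ valid (eval e v) /\ val (eval e u) < val (eval e v).
    by rewrite sat_rat_lt !mul0r !addr0.
  have c2 := c1 v3 v1; have c3 := c1 v1 (grid v4 v5); have c4 := c1 v3 v0.
  have c5 := c1 v0 (grid v4 v5); rewrite ge in c3 c5.
  have cl : sat (real_close (Var (VS (VS (VS (VS (VS (VS (VS (VS VZ)))))))) @ (CPi @ v1))
     (Var (VS (VS (VS (VS (VS (VS (VS (VS VZ)))))))) @ (CPi @ v0)) v2) e <->
    rclose (app f (rconst a)) (app f (rconst b)) k by rewrite sat_real_close.
  split=> h.
    move=> en ia ib vp va l1 l2 vb l3 l4.
    exact: (proj1 cl (h en (proj2 i1 ia) (proj2 i2 ib)
      (proj2 c2 (conj vp (conj va l1))) (proj2 c3 (conj va (conj gv l2)))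
      (proj2 c4 (conj vp (conj vb l3))) (proj2 c5 (conj vb (conj gv l4))))).
  move=> en /i1 ia /i2 ib /c2[vp [va l1]] /c3[_ [_ l2]] /c4[_ [vb l3]] /c5[_ [_ l4]].
  exact: (proj2 cl (h en ia ib vp va l1 l2 vb l3 l4)).
by split=> h p k a b; apply/core; apply: h.
Qed.

(** In the inner abstraction [v3] is the functional E. The search stops at [exp2 @ (v0 + One)], the
    index of the grid point 1. As a single term in [f] and E it gives the whole sequence at once,
    with no choice of witnesses for the individual indices. *)
Definition jump_seq : tm [ty2; ty1 ~> ty1] (Nat ~> ty1) :=
  lam (lam (grid (bmax @ lam (chi osc_fm v3) @ (exp2 @ (v0 + One)%tm)) v0)).

Lemma jump_seqP f E n : exists2_spec E ->
  approximates f n (app (eval (E0 ;; f ;; E) jump_seq) n).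
Proof.
move=> hE m; set s := app _ n.
pose e := E0 ;; f ;; E ;; n ;; m.
pose c := eval e (lam (chi osc_fm v3)); pose I := bm c (ex2 (m + 1)%mod).
have hc j : app c j = m0 <-> osc f n (iota j * p2 (m + 1)%mod).
  by rewrite /c eval_lam -chiP ?sat_osc //; apply: arith_osc.
have es : app s m = eval e (grid (bmax @ lam (chi osc_fm v3) @ (exp2 @ (v0 + One)%tm)) v0).
  by rewrite /s /jump_seq !eval_lam.
have [gv ge] := eval_grid e (bmax @ lam (chi osc_fm v3) @ (exp2 @ (v0 + One)%tm)) v0.
rewrite -es in gv ge.
have {ge} eX : approx s m = iota I * p2 (m + 1)%mod by exact: ge.
have hp := p2_gt0 (m + 1)%mod.
have e1 : iota (ex2 (m + 1)%mod) * p2 (m + 1)%mod = 1.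
  by rewrite /p2 divff // gt_eqF // iota_ex2_gt0.
have [b1 [b2 b3]] := bmP c (ex2 (m + 1)%mod).
have hI : iota I <= iota (ex2 (m + 1)%mod).
  by move: b1; rewrite mltnS => -[/iota_lt/ltW //|e']; rewrite /I e'.
split=> //; rewrite eX; split; first by apply: mulr_ge0 => //; apply: ltW.
split; first by rewrite -e1 ler_pM2r.
split.
  by case: b2 => [h|/hc]; [left; rewrite /I h iota0 mul0r|right].
case: b3 => [h|h]; [left|right]; first by rewrite /I h.
by move=> h'; apply/h/hc; rewrite iotaD iota1 mulrDl mul1r.
Qed.

Lemma jump_seq_exists (f : dom M (ty1 ~> ty1)) : (forall y, inunit y -> isreal (app f y)) ->
  exists s : dom M (Nat ~> ty1), (forall n, isreal (app s n)) /\
  forall x, inunit x -> jump f x -> exists n, req (app s n) x.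
Proof.
move=> hf; have [E hE] := aca_exists2E M.
exists (eval (E0 ;; f ;; E) jump_seq); split=> [n|x [hx _] hj].
  exact: approximates_real (jump_seqP f n hE).
have [n [hb ha]] := jump_index hf hx hj; exists n.
have [h0 [h1 _]] := hj.
exact: approximates_jump hx h0 h1 hb ha (jump_seqP f n hE).
Qed.

Lemma jump_sat : sat (All (ty1 ~> ty1)
      (unit_fun v0 --> regulated v0 -->
       Ex (Nat ~> ty1)
         (All Nat (is_real (v1 @ v0)) /\
          All ty1
            (in_unit v0 --> jump_discontinuity v2 v0 -->
             Ex Nat (real_eq (v2 @ v0) v1)))))%fm E0.
Proof.
rewrite sat_all => f; rewrite sat_imp => hu; rewrite sat_imp => _; rewrite sat_ex.
have hf y : inunit y -> isreal (app f y).
  move=> hy; have [h _] := proj1 (sat_and _ _ _) hu.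
  have h1 := proj2 (sat_in_unit (E0 ;; f ;; y) v0) hy.
  exact: (proj1 (sat_is_real (E0 ;; f ;; y) (v1 @ v0)) (h y h1)).
have [s [hs hj]] := jump_seq_exists hf; exists s.
rewrite sat_and; split.
  by rewrite sat_all => n; rewrite sat_is_real; apply: hs.
rewrite sat_all => x; rewrite sat_imp sat_in_unit => hx; rewrite sat_imp sat_jump => hjx.
have [n hn] := hj x hx hjx.
by rewrite sat_ex; exists n; rewrite sat_real_eq.
Qed.
End Reals.

Theorem theorem2p16 :
  provable ACA0w
    (All (ty1 ~> ty1)
      (unit_fun v0 --> regulated v0 -->
       Ex (Nat ~> ty1)
         (All Nat (is_real (v1 @ v0)) /\
          All ty1
            (in_unit v0 --> jump_discontinuity v2 v0 -->
             Ex Nat (real_eq (v2 @ v0) v1))))).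
Proof.
apply: completeness; first exact: ACA0w_stable.
  by move=> G a b; apply: aca_rca; apply: ax_ext.
move=> M hM; pose A := Aca hM.
exact: (@jump_sat A _ (@iota A) (@iota0 A) (@iota1 A) (@iotaD A) (@iotaM A)
  (@iota_inj A) (@iota_ge0 A) (@iota_lt A) (@fracE A)).
Qed.
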